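(* Fix $\lambda$. There exist unique elements $\xi_I\in(\mathbb C^N)^{\otimes n}\otimes\mathbb C[z^{\pm1},h^{\pm1},D^{-1}]$, $I\in\mathcal I_\lambda$, such that $\xi_{I^{\min}}=v_{I^{\min}}$ and $\xi_{s_i(I)}=\tilde s_i\,\xi_I$ for every $I\in\mathcal I_\lambda$ and $i=1,\dots,n-1$. Moreover $\xi_I=\sum_{J\le_{\mathrm{id}}I}X_{I,J}v_J$ with $X_{I,J}\in\mathbb C[z^{\pm1},h^{\pm1},D^{-1}]$, $X_{I,I}=\prod_{k<l}\prod_{a\in I_k}\prod_{b\in I_l,\,b<a}\frac{1-z_b/z_a}{1-hz_b/z_a}$, and for all $I,J$: $X_{I,J}=h^{p(J)}\,\widetilde W_{\sigma_0,J}(z_I^{-1},z^{-1},h^{-1})\,\frac{P(z_I)}{Q(z_I,h)}$.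
   Context: $v_1,\dots,v_N$ standard basis of $\mathbb C^N$; $\mathcal I_\lambda$ = ordered partitions $I=(I_1,\dots,I_N)$ of $\{1..n\}$ with $|I_k|=\lambda_k$; $v_I=v_{i_1}\otimes\dots\otimes v_{i_n}$, $i_j=k$ iff $j\in I_k$. $s_i(I)$: $I$ with $i$ and $i+1$ swapped. $I^{\min}=(\{1,\dots,\lambda_1\},\{\lambda_1+1,\dots,\lambda_1+\lambda_2\},\dots,\{n-\lambda_N+1,\dots,n\})$. $D=\prod_{1\le b<a\le n}(1-hz_b/z_a)$. Order $\le_{\mathrm{id}}$: with $I_1\cup\dots\cup I_k=\{a^k_1<\dots\}$, $J_1\cup\dots\cup J_k=\{b^k_1<\dots\}$, $J\le_{\mathrm{id}}I$ iff $b^k_i\le a^k_i$ for all $k<N$, $i$. $\mathcal R(z,h)$: $v_i\otimes v_i\mapsto v_i\otimes v_i$; for $i<j$, $v_i\otimes v_j\mapsto\frac{1-z}{1-hz}v_i\otimes v_j+\frac{(1-h)z}{1-hz}v_j\otimes v_i$, $v_j\otimes v_i\mapsto\frac{1-h}{1-hz}v_i\otimes v_j+\frac{h(1-z)}{1-hz}v_j\otimes v_i$. On $(\mathbb C^N)^{\otimes n}$-valued functions $f(z,h)$: $K_i$ swaps $z_i,z_{i+1}$ in the argument; $P^{(i,i+1)}$ swaps the $i$-th and $(i+1)$-st tensor factors; $\tilde s_i f=P^{(i,i+1)}\mathcal R^{(i,i+1)}(z_i/z_{i+1},h)\,(K_if)$. $p(J)$ = number of inversions in the sequence listing $J_N$,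 then $J_{N-1}$, ..., then $J_1$, each in increasing order. $P(z_I)=\prod_{k<l}\prod_{a\in I_k}\prod_{b\in I_l}(-z_b/z_a)$, $Q(z_I,h)=\prod_{k<l}\prod_{a\in I_k}\prod_{b\in I_l}(1-hz_b/z_a)$. $\sigma_0(m)=n+1-m$. Weight functions: $\lambda^{(k)}=\lambda_1+\dots+\lambda_k$, $I_1\cup\dots\cup I_k=\{i^{(k)}_1<\dots\}$, $t^{(N)}_a=z_a$, $U_I=\prod_{k=1}^{N-1}\prod_{a=1}^{\lambda^{(k)}}\Big(\prod_{c:\,i^{(k+1)}_c<i^{(k)}_a}(1-ht^{(k+1)}_c/t^{(k)}_a)\prod_{c:\,i^{(k+1)}_c>i^{(k)}_a}(1-t^{(k+1)}_c/t^{(k)}_a)\prod_{b>a}\frac{1-ht^{(k)}_b/t^{(k)}_a}{1-t^{(k)}_b/t^{(k)}_a}\Big)$, $W_I=(1-h)^{\sum_{k<N}\lambda^{(k)}}\mathrm{Sym}_{t^{(1)}}\cdots\mathrm{Sym}_{t^{(N-1)}}U_I$, $W_{\sigma,I}(t,z,h)=W_{\sigma^{-1}(I)}(t,z_{\sigma(1)},\dots,z_{\sigma(n)},h)$, $E=\prod_{k<N}\prod_{a,b}(1-ht^{(k)}_b/t^{(k)}_a)$, $\widetilde W=W/E$; $f(z_I,z,h)$ is the substitution $t^{(k)}_a=z_{i^{(k)}_a}$, and $\widetilde W_{\sigma_0,J}(z_I^{-1},z^{-1},h^{-1})$ is the Laurent polynomial $\widetilde W_{\sigma_0,J}(z_I,z,h)$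 with all $z_i\mapsto z_i^{-1}$, $h\mapsto h^{-1}$. *)

(* Defs.v *)
From HB Require Import structures.
From mathcomp Require Import all_boot all_order all_algebra all_fingroup.
Set Implicit Arguments. Unset Strict Implicit. Unset Printing Implicit Defensive.
Import Order.TTheory GRing.Theory Num.Theory.
Local Open Scope ring_scope.

(* An ordered partition I = (I_1,...,I_N) of {1..n} is encoded by its word
   j |-> k iff j in I_k (0-based positions and 0-based block labels).
   v_I is the basis vector of (C^N)^{(x)n} indexed by that word. *)
Notation word n N := {ffun 'I_n -> 'I_N}.

Definition inIlam {n N} (lam : 'I_N -> nat) (w : word n N) : bool :=
  [forall k : 'I_N, #|[pred j | w j == k]| == lam k].

(* lambda^{(k+1)} (0-based k) and lambda_1+...+lambda_k *)
Definition cum {N} (lam : 'I_N -> nat) (k : nat) : nat :=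
  (\sum_(m < N | (m <= k)%N) lam m)%N.
Definition cumb {N} (lam : 'I_N -> nat) (k : nat) : nat :=
  (\sum_(m < N | (m < k)%N) lam m)%N.

Definition Imin {n N} (lam : 'I_N -> nat) (hN : (0 < N)%N) : word n N :=
  [ffun j : 'I_n => odflt (Ordinal hN)
     [pick k : 'I_N | (cumb lam k <= j < cum lam k)%N]].

(* vectors of (C^N)^{(x) n}: coordinates in the basis (v_w) *)
Definition vb {C : numClosedFieldType} {n N} (w : word n N) : word n N -> C :=
  fun u => (u == w)%:R.

Definition zat {C : numClosedFieldType} {n} (z : 'I_n -> C) (a : nat) : C :=
  match (insub a : option 'I_n) with Some j => z j | None => 0 end.

Definition Dfun {C : numClosedFieldType} {n} (z : 'I_n -> C) (h : C) : C :=
  \prod_(a < n) \prod_(b < n | (b < a)%N) (1 - h * z b / z a).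

(* the variety U = { z_i <> 0, h <> 0, D <> 0 }, whose ring of regular functions
   is C[z^{+-1}, h^{+-1}, D^{-1}] *)
Definition inU {C : numClosedFieldType} {n} (z : 'I_n -> C) (h : C) : Prop :=
  [/\ forall j, z j != 0, h != 0 & Dfun z h != 0].

Definition lpoly {C : numClosedFieldType} {n}
    (s : seq (C * (int * {ffun 'I_n -> int}))) (z : 'I_n -> C) (h : C) : C :=
  \sum_(t <- s) t.1 * (h ^ t.2.1 * \prod_(j < n) z j ^ t.2.2 j).

(* f is (the function on U of) an element of C[z^{+-1}, h^{+-1}, D^{-1}] *)
Definition regular {C : numClosedFieldType} {n} (f : ('I_n -> C) -> C -> C) : Prop :=
  exists (s : seq (C * (int * {ffun 'I_n -> int}))) (k : nat),
    forall z h, inU z h -> f z h = lpoly s z h / Dfun z h ^+ k.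

(* generic points: a dense open subset of U on which all rational expressions
   below are defined *)
Definition generic {C : numClosedFieldType} {n} (z : 'I_n -> C) (h : C) : Prop :=
  [/\ forall j, z j != 0, h != 0, h != 1 &
      forall a b : 'I_n, a != b -> (z a != z b) && (z b != h * z a)].

Definition tau {n} (i : nat) (j : 'I_n) : 'I_n :=
  insubd j (if val j == i then i.+1 else if val j == i.+1 then i else val j).
Definition swapw {n N} (i : nat) (w : word n N) : word n N := [ffun j => w (tau i j)].
Definition swapz {C : numClosedFieldType} {n} (i : nat) (z : 'I_n -> C) : 'I_n -> C :=
  fun j => z (tau i j).

Definition wat {n N} (w : word n N) (p : nat) : nat :=
  match (insub p : option 'I_n) with Some j => val (w j) | None => 0%N end.

(* coefficient of v_u in R^{(i,i+1)}(x,h) v_w *)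
Definition Rcoef {C : numClosedFieldType} {n N} (x h : C) (i : nat) (u w : word n N) : C :=
  let a := wat w i in let b := wat w i.+1 in
  if u == w then
    (if a == b then 1
     else if (a < b)%N then (1 - x) / (1 - h * x)
     else h * (1 - x) / (1 - h * x))
  else if u == swapw i w then
    (if (a < b)%N then (1 - h) * x / (1 - h * x)
     else if (b < a)%N then (1 - h) / (1 - h * x) else 0)
  else 0.

Definition Rop {C : numClosedFieldType} {n N} (x h : C) (i : nat)
    (v : word n N -> C) : word n N -> C :=
  fun u => \sum_(w : word n N) Rcoef x h i u w * v w.

Definition Pop {C : numClosedFieldType} {n N} (i : nat) (v : word n N -> C) : word n N -> C :=
  fun u => v (swapw i u).

Definition stilde {C : numClosedFieldType} {n N} (i : nat)
    (f : ('I_n -> C) -> C -> word n N -> C) : ('I_n -> C) -> C -> word n N -> C :=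
  fun z h => Pop i (Rop (zat z i / zat z i.+1) h i (f (swapz i z) h)).

(* increasing list of I_1 u ... u I_{k+1} (0-based k) *)
Definition cumset {n N} (w : word n N) (k : nat) : seq nat :=
  [seq val j | j <- [seq j <- enum 'I_n | (val (w j) <= k)%N]].

Definition le_id {n N} (J I : word n N) : bool :=
  [forall k : 'I_N, (k.+1 < N)%N ==> all2 leq (cumset J k) (cumset I k)].

Definition inversions (s : seq nat) : nat :=
  (\sum_(p < size s) \sum_(q < size s)
     ((p < q)%N && (nth 0%N s q < nth 0%N s p)%N : nat))%N.

Definition pinv {n N} (J : word n N) : nat :=
  inversions (flatten [seq [seq val j | j <- [seq j <- enum 'I_n | J j == k]]
                      | k <- rev (enum 'I_N)]).

(* P(z_I), Q(z_I,h): k<l, a in I_k, b in I_l  <=>  I(a) < I(b) *)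
Definition Pz {C : numClosedFieldType} {n N} (I : word n N) (z : 'I_n -> C) : C :=
  \prod_(a < n) \prod_(b < n | (val (I a) < val (I b))%N) (- (z b / z a)).
Definition Qz {C : numClosedFieldType} {n N} (I : word n N) (z : 'I_n -> C) (h : C) : C :=
  \prod_(a < n) \prod_(b < n | (val (I a) < val (I b))%N) (1 - h * z b / z a).

Definition Xdiag {C : numClosedFieldType} {n N} (I : word n N) (z : 'I_n -> C) (h : C) : C :=
  \prod_(a < n) \prod_(b < n | (val (I a) < val (I b))%N && (b < a)%N)
     ((1 - z b / z a) / (1 - h * z b / z a)).

(* variables: t k a = t^{(k+1)}_{a+1} for k < N-1; level N-1 is z *)
Definition Tv {C : numClosedFieldType} {n} (N : nat) (t : nat -> nat -> C)
    (z : 'I_n -> C) (k a : nat) : C :=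
  if (k.+1 < N)%N then t k a else zat z a.

(* i^{(k+1)}_{a+1} (0-based) *)
Definition idx {n N} (I : word n N) (k a : nat) : nat := nth 0%N (cumset I k) a.

Definition Ufun {C : numClosedFieldType} {n N} (lam : 'I_N -> nat) (I : word n N)
    (t : nat -> nat -> C) (z : 'I_n -> C) (h : C) : C :=
  \prod_(k < N.-1) \prod_(a < cum lam k)
   ( (\prod_(c < cum lam k.+1 | (idx I k.+1 c < idx I k a)%N)
         (1 - h * Tv N t z k.+1 c / Tv N t z k a))
   * (\prod_(c < cum lam k.+1 | (idx I k a < idx I k.+1 c)%N)
         (1 - Tv N t z k.+1 c / Tv N t z k a))
   * \prod_(b < cum lam k | (a < b)%N)
         ((1 - h * Tv N t z k b / Tv N t z k a) / (1 - Tv N t z k b / Tv N t z k a)) ).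

(* a family (sigma_1,...,sigma_{N-1}) with sigma_k in S_{lambda^{(k)}}, encoded as
   permutations of 'I_n fixing every j >= lambda^{(k)} (and sigma at level N = id) *)
Definition symfam {n N} (lam : 'I_N -> nat) : pred {ffun 'I_N -> {perm 'I_n}} :=
  fun f => [forall k : 'I_N, forall j : 'I_n,
              (((k.+1 < N)%N ==> (cum lam k <= j)%N) ==> (f k j == j))].

Definition applyp {n} (s : {perm 'I_n}) (a : nat) : nat :=
  match (insub a : option 'I_n) with Some j => val (s j) | None => a end.
Definition fam_at {n N} (f : {ffun 'I_N -> {perm 'I_n}}) (k : nat) : {perm 'I_n} :=
  match (insub k : option 'I_N) with Some k' => f k' | None => 1%g end.
Definition permt {C : numClosedFieldType} {n N} (f : {ffun 'I_N -> {perm 'I_n}})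
    (t : nat -> nat -> C) : nat -> nat -> C :=
  fun k a => t k (applyp (fam_at f k) a).

(* W_I = (1-h)^{sum_{k<N} lambda^{(k)}} Sym_{t^(1)} ... Sym_{t^(N-1)} U_I,
   Sym f = sum over permutations (no normalisation) *)
Definition Wfun {C : numClosedFieldType} {n N} (lam : 'I_N -> nat) (I : word n N)
    (t : nat -> nat -> C) (z : 'I_n -> C) (h : C) : C :=
  (1 - h) ^+ (\sum_(k < N.-1) cum lam k)%N
  * \sum_(f in symfam (n:=n) lam) Ufun lam I (permt f t) z h.

Definition Efun {C : numClosedFieldType} {N} (lam : 'I_N -> nat)
    (t : nat -> nat -> C) (h : C) : C :=
  \prod_(k < N.-1) \prod_(a < cum lam k) \prod_(b < cum lam k) (1 - h * t k b / t k a).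

Definition Wtil {C : numClosedFieldType} {n N} (lam : 'I_N -> nat) (I : word n N)
    (t : nat -> nat -> C) (z : 'I_n -> C) (h : C) : C :=
  Wfun lam I t z h / Efun lam t h.

(* sigma_0^{-1}(J), sigma_0(m) = n+1-m *)
Definition revw {n N} (J : word n N) : word n N := [ffun j => J (rev_ord j)].

Definition Wtil_s0 {C : numClosedFieldType} {n N} (lam : 'I_N -> nat) (J : word n N)
    (t : nat -> nat -> C) (z : 'I_n -> C) (h : C) : C :=
  Wtil lam (revw J) t (fun j => z (rev_ord j)) h.

Definition Xformula {C : numClosedFieldType} {n N} (lam : 'I_N -> nat) (I J : word n N)
    (z : 'I_n -> C) (h : C) : C :=
  h ^+ pinv J
  * Wtil_s0 lam J (fun k a => (zat z (idx I k a))^-1) (fun j => (z j)^-1) h^-1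
  * Pz I z / Qz I z h.

(* Main.v *)
Require Import Defs.
From HB Require Import structures.
From mathcomp Require Import all_boot all_order all_algebra all_fingroup.
From mathcomp Require Import ring zify.
Set Implicit Arguments. Unset Strict Implicit. Unset Printing Implicit Defensive.
Import Order.TTheory GRing.Theory Num.Theory.
Local Open Scope ring_scope.

(** No Yang-Baxter argument is needed: the explicit formula satisfies the recursion.
    Writing each weight function as a nested sum over partial bijections from the
    positions {J <= k} to {I <= k}, the swap of z_i and z_(i+1) passes through the
    levels of the sum one at a time, and at each level it reduces to a two-variable
    rational identity.  Hence the coefficients X_(I,J) given by the formula satisfy
    X_(s_i I) = ~s_i X_I at generic points.  A nonzero term of the nested sum
    forces every bijection to move positions weakly to the right, which gives
    triangularity with respect to <=_id, and only the identity family survives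
    when I = J; for I = I^min this yields the initial condition.
    The vectors xi_I are built from v_(I^min) by undoing descents: since each step
    only adds the pole 1 - h z_b / z_a of the new inversion, they are regular.
    All remaining identities hold at generic points and extend to {D <> 0}
    because two regular functions that agree at generic points are equal. *)

(** The induction over levels works because two roles of z are decoupled. In [nested], [y] gives the
    values substituted for the summed variables and [Y] the variables of the topmost level; in the
    formula both are z^-1. Replacing I by s_i(I) acts on [y] only, and the effect of replacing J by
    s_i(J) is expressed through [Y a], [Y b] by a relation of Demazure-Lusztig type ([nested_swap]).
    For one fixed [y] it is applied with two tops, z^-1 and its swap; the two linear equations,
    solved for the wanted term, give the entries of the R-matrix. The power h^p(J) converts the h^-1
    of that relation into the h of the R-matrix.

    The obstacle to regularity is that D is not symmetric in z: ~s_i replaces D(z) by D(s_i z),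
    which has a factor 1 - h z_(i+1)/z_i absent from D(z). Hence denominators are attached to the
    inversions of each word, and the recursion is asserted where both D(z) and D(s_i z) are
    nonzero. *)

(** * Adjacent transpositions acting on positions and words *)

Section Transposition.
Variables (n i : nat).
Hypothesis hi : (i.+1 < n)%N.

Lemma val_tau (j : 'I_n) :
  val (tau i j) = if val j == i then i.+1 else if val j == i.+1 then i else val j.
Proof.
rewrite /tau val_insubd; case: ifP => // /negP[]; have := ltn_ord j.
by case: eqP => // _; case: eqP => //; lia.
Qed.

Lemma tauK : involutive (tau i : 'I_n -> 'I_n).
Proof. by move=> j; apply/val_inj; rewrite !val_tau; do !case: eqP => //; lia. Qed.

Lemma tau_inj : injective (tau i : 'I_n -> 'I_n).
Proof. exact: inv_inj tauK. Qed.

Definition ord_lo : 'I_n := Ordinal (ltnW hi).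
Definition ord_hi : 'I_n := Ordinal hi.

Lemma tau_lo : tau i ord_lo = ord_hi.
Proof. by apply/val_inj; rewrite val_tau /= eqxx. Qed.

Lemma tau_hi : tau i ord_hi = ord_lo.
Proof. by rewrite -tau_lo tauK. Qed.

Lemma tau_other (j : 'I_n) : j != ord_lo -> j != ord_hi -> tau i j = j.
Proof.
by rewrite -!val_eqE /= => /negPf h0 /negPf h1; apply/val_inj; rewrite val_tau h0 h1.
Qed.

Lemma tau_ltn (p q : 'I_n) :
  (p, q) != (ord_lo, ord_hi) -> (p, q) != (ord_hi, ord_lo) ->
  (tau i p < tau i q)%N = (p < q)%N.
Proof.
rewrite !xpair_eqE -!val_eqE /= => h0 h1.
have -> : (tau i p : nat) = val (tau i p) by [].
have -> : (tau i q : nat) = val (tau i q) by [].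
by rewrite !val_tau; do !case: eqP => /=; lia.
Qed.

End Transposition.

Section Words.
Variables (n N : nat).
Implicit Types w : word n N.

Lemma swapwE i w p : swapw i w p = w (tau i p).
Proof. by rewrite ffunE. Qed.

Lemma swapwK i w : (i.+1 < n)%N -> swapw i (swapw i w) = w.
Proof. by move=> hi; apply/ffunP=> p; rewrite !swapwE tauK. Qed.

Lemma inIlam_swapw lam i w : (i.+1 < n)%N -> inIlam lam (swapw i w) = inIlam lam w.
Proof.
move=> hi; apply/eq_forallb => k; congr (_ == _).
rewrite -!sum1_card [RHS](reindex_inj (tau_inj hi)) /=.
by apply: eq_bigl => p; rewrite !inE swapwE.
Qed.

Lemma wat_ord w (p : 'I_n) : wat w p = w p.
Proof. by rewrite /wat valK. Qed.

End Words.

Lemma zat_ord (C : numClosedFieldType) n (z : 'I_n -> C) (p : 'I_n) : zat z p = z p.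
Proof. by rewrite /zat valK. Qed.

(** * One level of the weight function under a swap of adjacent positions *)

Section Level.
Variables (C : numClosedFieldType) (n N : nat) (h : C).
Implicit Types (J : word n N) (X Y : 'I_n -> C).

(** Reversing the word reverses the comparisons of U, so the factor with h belongs to p < q; equal
    positions contribute nothing, as in U. With guards worth 1 instead of restricted index sets, the
    products can be reindexed by [tau] freely. *)
Definition cross_factor J k X Y (p q : 'I_n) : C :=
  if (J p <= k)%N && (J q <= k.+1)%N then
    if (p < q)%N then 1 - h * Y q / X p else if (q < p)%N then 1 - Y q / X p else 1
  else 1.

Definition self_factor J k X (p q : 'I_n) : C :=
  if [&& (J p <= k)%N, (J q <= k)%N & (q < p)%N]
  then (1 - h * X q / X p) / (1 - X q / X p) else 1.

(* The [k]-th factor of [U] for the reversed word: here [X] and [Y] are the values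
   of t^(k) and t^(k+1), indexed by the positions of the letters of [J]. *)
Definition level J k X Y : C :=
  \prod_(pq : 'I_n * 'I_n) (cross_factor J k X Y pq.1 pq.2 * self_factor J k X pq.1 pq.2).

Lemma eq_level J J' k X X' Y Y' :
    (forall p, (J p <= k)%N = (J' p <= k)%N) ->
    (forall p, (J p <= k.+1)%N = (J' p <= k.+1)%N) ->
    (forall p, (J p <= k)%N -> X p = X' p) ->
    (forall p, (J p <= k.+1)%N -> Y p = Y' p) ->
  level J k X Y = level J' k X' Y'.
Proof.
move=> eJ eJ1 eX eY; apply: eq_bigr => -[p q] _ /=; congr (_ * _).
  rewrite /cross_factor -eJ -eJ1; case: ifP => // /andP[hp hq].
  by rewrite eX // eY.
rewrite /self_factor -!eJ; case: ifP => // /and3P[hp hq _].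
by rewrite !eX.
Qed.

Section Swap.
Variable i : nat.
Hypothesis hi : (i.+1 < n)%N.
Local Notation a := (ord_lo hi).
Local Notation b := (ord_hi hi).
Local Notation s := (@tau n i).

(** The two pairs left out are the only ones whose order [tau] changes. *)
Definition rest J k X Y : C :=
  \prod_(pq : 'I_n * 'I_n | (pq != (a, b)) && (pq != (b, a)))
     (cross_factor J k X Y pq.1 pq.2 * self_factor J k X pq.1 pq.2).

Lemma neqab : (a == b) = false. Proof. by rewrite -val_eqE /= ltn_eqF. Qed.

Lemma level_split J k X Y :
  level J k X Y = rest J k X Y *
    (cross_factor J k X Y a b * cross_factor J k X Y b a * self_factor J k X b a).
Proof.
rewrite /level (bigD1 (a, b)) //= (bigD1 (b, a)) /=; last first.
  by rewrite xpair_eqE eq_sym neqab.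
rewrite -/(rest J k X Y).
have -> : self_factor J k X a b = 1.
  by rewrite /self_factor [(b < a)%N]ltnNge leqnSn !andbF.
ring.
Qed.

Lemma rest_swap J k X Y :
  rest (swapw i J) k (X \o s) (Y \o s) = rest J k X Y.
Proof.
have s2_inj : injective (fun pq : 'I_n * 'I_n => (s pq.1, s pq.2)).
  by move=> [p q] [p' q'] [/(tau_inj hi) -> /(tau_inj hi) ->].
rewrite /rest [RHS](reindex_inj s2_inj) /=.
apply: eq_big => [[p q]|[p q] /andP[h0 h1]] /=.
  have ea x : (s x == a) = (x == b) by rewrite -(tau_hi hi) (inj_eq (tau_inj hi)).
  have eb x : (s x == b) = (x == a) by rewrite -(tau_lo hi) (inj_eq (tau_inj hi)).
  by rewrite !xpair_eqE !ea !eb andbC.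
have h0' : (q, p) != (a, b) by rewrite xpair_eqE andbC -xpair_eqE.
have h1' : (q, p) != (b, a) by rewrite xpair_eqE andbC -xpair_eqE.
by rewrite /cross_factor /self_factor !swapwE !(tau_ltn h0 h1) !(tau_ltn h0' h1').
Qed.

(** A row p outside {a, b} lies on the same side of a and b, so the swap of Y exchanges its factors
    in these two columns. In rows a and b nothing moves: one of the two columns is the diagonal,
    with factor 1, and the other is excluded. *)
Lemma rest_swapY J k X Y : (J a <= k.+1)%N -> (J b <= k.+1)%N ->
  rest J k X (Y \o s) = rest J k X Y.
Proof.
move=> ha hb; rewrite /rest !big_split /=; congr (_ * _).
pose f (pq : 'I_n * 'I_n) := (pq.1, if (pq.1 == a) || (pq.1 == b) then pq.2 else s pq.2).
have fK : involutive f.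
  by move=> [p q]; rewrite /f /=; case: (_ || _) => //=; rewrite tauK.
rewrite [RHS](reindex_inj (inv_inj fK)) /=.
apply: eq_big => [[p q]|[p q] /andP[]]; rewrite /f /=.
  case: ifP => //= /norP[/negPf pa /negPf pb].
  by rewrite !xpair_eqE /= pa pb.
have hsJ x : (J (s x) <= k.+1)%N = (J x <= k.+1)%N.
  have [->|xa] := eqVneq x a; first by rewrite tau_lo ha hb.
  have [->|xb] := eqVneq x b; first by rewrite tau_hi ha hb.
  by rewrite tau_other.
rewrite !xpair_eqE !negb_and /cross_factor /=.
have [->|pa] := eqVneq p a; rewrite /= ?neqab /=.
  move=> qb _; have [->|qa] := eqVneq q a; first by rewrite ltnn.
  by rewrite tau_other.
have [->|pb] /= := eqVneq p b.
  move=> _ qa; have [->|qb] := eqVneq q b; first by rewrite ltnn.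
  by rewrite tau_other.
move=> _ _; have sp : tau i p = p by rewrite tau_other.
have hl x y : (x, y) != (a, b) -> (x, y) != (b, a) -> (s x < s y)%N = (x < y)%N.
  exact: tau_ltn.
have e1 : (p < s q)%N = (p < q)%N.
  by rewrite -{1}sp hl // xpair_eqE negb_and ?pa ?pb.
have e2 : (s q < p)%N = (q < p)%N.
  by rewrite -{1}sp hl // xpair_eqE negb_and ?pa ?pb orbT.
by rewrite hsJ e1 e2.
Qed.

Lemma eq_rest J J' k X X' Y Y' :
    (forall p, (J p <= k)%N = (J' p <= k)%N) ->
    (forall p, (J p <= k.+1)%N = (J' p <= k.+1)%N) ->
    X =1 X' -> Y =1 Y' -> rest J k X Y = rest J' k X' Y'.
Proof.
move=> eJ eJ1 eX eY; apply: eq_bigr => -[p q] _ /=.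
by rewrite /cross_factor /self_factor !eJ !eJ1 !eX !eY.
Qed.

Lemma swapw_le J k p : (J a <= k)%N = (J b <= k)%N -> (swapw i J p <= k)%N = (J p <= k)%N.
Proof.
move=> e; rewrite swapwE; have [->|pa] := eqVneq p a; first by rewrite tau_lo e.
by have [->|pb] := eqVneq p b; [rewrite tau_hi e | rewrite tau_other].
Qed.

Lemma rest_swapX J k X Y : (J a <= k)%N -> (J b <= k)%N ->
  rest J k (X \o s) Y = rest J k X Y.
Proof.
move=> ha hb; rewrite -(rest_swapY X Y (leqW ha) (leqW hb)) -(rest_swap J).
apply: eq_rest => p //=; rewrite ?swapw_le ?ha ?hb ?(leqW ha) ?(leqW hb) //.
by rewrite tauK.
Qed.

(** The two special pairs contribute 1, and [rest] is invariant when J, X and Y are swapped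
    together. *)
Lemma level_swap_far J k X Y :
    ~~ ((J a <= k) && (J b <= k.+1))%N -> ~~ ((J b <= k) && (J a <= k.+1))%N ->
  level (swapw i J) k (X \o s) Y = level J k X (Y \o s).
Proof.
move=> /negPf ha /negPf hb; rewrite !level_split.
rewrite /cross_factor /self_factor !swapwE !tau_lo !tau_hi ha hb /=.
have -> : [&& (J b <= k)%N, (J a <= k)%N & (a < b)%N] = false.
  by apply/negP => /and3P[h1 h2 _]; rewrite h1 (leqW h2) in hb.
have -> : [&& (J a <= k)%N, (J b <= k)%N & (a < b)%N] = false.
  by apply/negP => /and3P[h1 h2 _]; rewrite h1 (leqW h2) in ha.
congr (_ * _); rewrite -[RHS]rest_swap; apply: eq_rest => // p.
by rewrite /= tauK.
Qed.

(** Only the letter at b has a variable in X, so one special factor survives in each term: 1 - h Y b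
    / X b on the left, where that letter has moved to a, and 1 - Y a / X b, 1 - Y b / X b on the
    right. *)
Lemma level_swap_mid J k X Y : (k < J a <= k.+1)%N -> (J b <= k)%N ->
  (Y b - Y a) * level (swapw i J) k (X \o s) Y =
  (1 - h) * Y b * level J k X Y + (h * Y b - Y a) * level J k X (Y \o s).
Proof.
move=> /andP[ha1 ha2] hb; have ha3 : (J a <= k)%N = false by rewrite leqNgt ha1.
rewrite !level_split rest_swapY ?(leqW hb) //.
have -> : rest (swapw i J) k (X \o s) Y = rest J k X Y.
  rewrite -[RHS]rest_swapY ?(leqW hb) // -[RHS]rest_swap.
  by apply: eq_rest => // p; rewrite /= tauK.
rewrite /cross_factor /self_factor !swapwE /= !tau_lo !tau_hi ha2 ha3 hb (leqW hb) /=.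
rewrite ltnSn ltnNge leqnSn /=; ring.
Qed.

Definition pair_kernel (xa xb ya yb : C) : C :=
  (1 - h * yb / xa) * (1 - ya / xb) * ((1 - h * xa / xb) / (1 - xa / xb)).

(** Transports symmetry upwards: a sum symmetrized over the lower variables is symmetric in the two
    upper ones. *)
Lemma pair_kernel_sym xa xb ya yb : xa != 0 -> xb != 0 -> xa != xb ->
  pair_kernel xa xb ya yb + pair_kernel xb xa ya yb =
  pair_kernel xa xb yb ya + pair_kernel xb xa yb ya.
Proof.
move=> xa0 xb0 xab; rewrite /pair_kernel; field.
by rewrite xa0 xb0 !subr_eq0 xab eq_sym xab.
Qed.

(** Transports the relation of [nested_swap] upwards. The coefficients on the left are those of the
    relation in xa, xb, the second one after exchanging xa and xb; those on the right belong to the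
    same relation in ya, yb. *)
Lemma pair_kernel_intertwine xa xb ya yb : xa != 0 -> xb != 0 -> xa != xb ->
  (yb - ya) * ((1 - h) * xb / (xb - xa) * pair_kernel xa xb ya yb
     + (h * xa - xb) / (xa - xb) * pair_kernel xb xa ya yb)
  = (1 - h) * yb * pair_kernel xa xb ya yb
     + (h * yb - ya) * pair_kernel xa xb yb ya.
Proof.
move=> xa0 xb0 xab; rewrite /pair_kernel; field.
by rewrite xa0 xb0 !subr_eq0 xab eq_sym xab.
Qed.

Lemma level_both J k X Y : (J a <= k)%N -> (J b <= k)%N ->
  level J k X Y = rest J k X Y * pair_kernel (X a) (X b) (Y a) (Y b).
Proof.
move=> ha hb; rewrite level_split /cross_factor /self_factor ha hb (leqW ha) (leqW hb) /=.
by rewrite ltnSn ltnNge leqnSn /=.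
Qed.

Lemma level_both_sym J k X Y : (J a <= k)%N -> (J b <= k)%N ->
    X a != 0 -> X b != 0 -> X a != X b ->
  level J k X Y + level J k (X \o s) Y = level J k X (Y \o s) + level J k (X \o s) (Y \o s).
Proof.
move=> ha hb xa0 xb0 xab; rewrite !level_both // !rest_swapX // rest_swapY ?leqW //.
by rewrite -!mulrDr /= !tau_lo !tau_hi pair_kernel_sym.
Qed.

Lemma level_both_intertwine J k X Y : (J a <= k)%N -> (J b <= k)%N ->
    X a != 0 -> X b != 0 -> X a != X b ->
  (Y b - Y a) * ((1 - h) * X b / (X b - X a) * level J k X Y
     + (h * X a - X b) / (X a - X b) * level J k (X \o s) Y)
  = (1 - h) * Y b * level J k X Y + (h * Y b - Y a) * level J k X (Y \o s).
Proof.
move=> ha hb xa0 xb0 xab; rewrite !level_both // !rest_swapX // rest_swapY ?leqW //.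
rewrite /= !tau_lo !tau_hi !(mulrCA _ (rest _ _ _ _)) -!mulrDr mulrCA.
by rewrite pair_kernel_intertwine.
Qed.

End Swap.
End Level.

(** * Partial bijections between positions of J and of I *)

Section PartialBijections.
Variables (n N : nat).
Implicit Types (I J : word n N) (g : {ffun 'I_n -> option 'I_n}).

(** g p = Some j means that the permuted level-k variable attached to the letter of J at p takes the
    value with index j. Being indexed by positions instead of ranks, g reacts to an adjacent swap by
    mere composition with [tau]. *)
Definition pbij I J k : {set {ffun 'I_n -> option 'I_n}} :=
  [set g : {ffun 'I_n -> option 'I_n} |
     [&& [forall p, isSome (g p) == (J p <= k)%N],
         [forall j, [exists p, g p == Some j] == (I j <= k)%N]
       & [forall p, forall q, (g p == g q) && isSome (g p) ==> (p == q)]]].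

Lemma pbijP I J k g :
  reflect [/\ forall p, isSome (g p) = (J p <= k)%N,
              forall j, (exists p, g p = Some j) <-> (I j <= k)%N
            & forall p q j, g p = Some j -> g q = Some j -> p = q]
          (g \in pbij I J k).
Proof.
rewrite inE; apply: (iffP and3P) => -[h1 h2 h3]; split.
- by move=> p; apply/eqP; apply: (forallP h1).
- move=> j; rewrite -(eqP (forallP h2 j)); split=> [[p /eqP gp]|/existsP[p /eqP gp]].
    by apply/existsP; exists p.
  by exists p.
- move=> p q j gp gq; apply/eqP.
  by apply: (implyP (forallP (forallP h3 p) q)); rewrite gp gq eqxx.
- by apply/forallP => p; rewrite h1.
- apply/forallP => j; apply/eqP; apply/idP/idP => [/existsP[p /eqP gp]|/h2[p gp]].
    by apply/h2; exists p.
  by apply/existsP; exists p; rewrite gp.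
- apply/forallP => p; apply/forallP => q; apply/implyP => /andP[/eqP e].
  by case gp: (g p) => [j|] // _; apply/eqP; apply: (h3 p q j); rewrite -?e.
Qed.

Definition pre_tau i g : {ffun 'I_n -> option 'I_n} := [ffun p => g (tau i p)].
Definition post_tau i g : {ffun 'I_n -> option 'I_n} := [ffun p => omap (tau i) (g p)].

Variable i : nat.
Hypothesis hi : (i.+1 < n)%N.

Lemma pre_tauK : involutive (pre_tau i).
Proof. by move=> g; apply/ffunP => p; rewrite !ffunE tauK. Qed.

Lemma post_tauK : involutive (post_tau i).
Proof.
by move=> g; apply/ffunP => p; rewrite !ffunE; case: (g p) => //= j; rewrite tauK.
Qed.

Lemma pbij_pre_tau I J k g : g \in pbij I J k -> pre_tau i g \in pbij I (swapw i J) k.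
Proof.
case/pbijP => h1 h2 h3; apply/pbijP; split=> [p|j|p q j]; rewrite ?ffunE ?h1 //.
  rewrite -h2; split=> -[p]; rewrite ?ffunE => gp; first by exists (tau i p).
  by exists (tau i p); rewrite ffunE tauK.
by move=> gp gq; apply: (tau_inj hi); apply: h3 gp gq.
Qed.

Lemma pbij_post_tau I J k g : g \in pbij I J k -> post_tau i g \in pbij (swapw i I) J k.
Proof.
case/pbijP => h1 h2 h3; apply/pbijP; split=> [p|j|p q j]; rewrite ?ffunE -?h1 //.
- by case: (g p).
- rewrite -h2; split=> -[p].
    by rewrite ffunE; case gp: (g p) => [x|] //= [<-]; exists p; rewrite tauK.
  by move=> gp; exists p; rewrite ffunE gp /= tauK.
case gp: (g p) => [x|] //= [<-]; case gq: (g q) => [x'|] //= [/(tau_inj hi) e].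
by apply: h3 gp _; rewrite gq e.
Qed.

Lemma big_pbij_pre (R : nmodType) I J k (G : {ffun 'I_n -> option 'I_n} -> R) :
  \sum_(g in pbij I (swapw i J) k) G g = \sum_(g in pbij I J k) G (pre_tau i g).
Proof.
rewrite (reindex_inj (inv_inj pre_tauK)) /=; apply: eq_bigl => g.
by apply/idP/idP => /pbij_pre_tau; rewrite ?pre_tauK ?swapwK.
Qed.

Lemma big_pbij_post (R : nmodType) I J k (G : {ffun 'I_n -> option 'I_n} -> R) :
  \sum_(g in pbij (swapw i I) J k) G g = \sum_(g in pbij I J k) G (post_tau i g).
Proof.
rewrite (reindex_inj (inv_inj post_tauK)) /=; apply: eq_bigl => g.
by apply/idP/idP => /pbij_post_tau; rewrite ?post_tauK ?swapwK.
Qed.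

Lemma eq_pbij I J J' k : (forall p, (J p <= k)%N = (J' p <= k)%N) -> pbij I J k = pbij I J' k.
Proof.
move=> e; apply/setP => g; rewrite !inE; congr [&& _, _ & _].
by apply: eq_forallb => p; rewrite e.
Qed.

End PartialBijections.

(** * Nested sums and their intertwining relation *)

Section NestedSum.
Variables (C : numClosedFieldType) (n N : nat) (h : C).
Implicit Types (I J : word n N) (X Y y : 'I_n -> C) (g : {ffun 'I_n -> option 'I_n}).

(** The default 0 occurs only outside the domain of g, where [level] and [nested] do not look. *)
Definition vals y g (p : 'I_n) : C := oapp y 0 (g p).

Fixpoint nested I y J k Y : C :=
  if k is k'.+1 then
    \sum_(g in pbij I J k') nested I y J k' (vals y g) * level h J k' (vals y g) Y
  else 1.

Lemma eq_nested I y J J' k Y Y' :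
    (forall m p, (m <= k)%N -> (J p <= m)%N = (J' p <= m)%N) ->
    (forall p, (J p <= k)%N -> Y p = Y' p) ->
  nested I y J k Y = nested I y J' k Y'.
Proof.
elim: k Y Y' => //= k IH Y Y' eJ eY.
rewrite (@eq_pbij _ _ _ _ J'); last by move=> p; apply: eJ.
apply: eq_bigr => g _; congr (_ * _); last first.
  by apply: eq_level => // p; apply: eJ.
by apply: IH => // m p /leqW; apply: eJ.
Qed.

Lemma eq_nested_pt I y y' J k Y Y' : y =1 y' -> Y =1 Y' ->
  nested I y J k Y = nested I y' J k Y'.
Proof.
move=> ey; elim: k Y Y' => //= k IH Y Y' eY; apply: eq_bigr => g _.
have ev : vals y g =1 vals y' g by move=> p; rewrite /vals; case: (g p) => //= j.
by congr (_ * _); [apply: IH | apply: eq_level].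
Qed.

Variable i : nat.
Hypothesis hi : (i.+1 < n)%N.
Local Notation a := (ord_lo hi).
Local Notation b := (ord_hi hi).
Local Notation s := (@tau n i).

Lemma vals_pre y g : vals y (pre_tau i g) =1 vals y g \o s.
Proof. by move=> p; rewrite /vals ffunE. Qed.

Lemma vals_post y g : vals y (post_tau i g) =1 vals (y \o s) g.
Proof. by move=> p; rewrite /vals ffunE; case: (g p). Qed.

Lemma nested_swapI I y J k Y : nested (swapw i I) y J k Y = nested I (y \o s) J k Y.
Proof.
elim: k Y => //= k IH Y; rewrite big_pbij_post //; apply: eq_bigr => g _.
rewrite IH; congr (_ * _); last by apply: eq_level => // p _; rewrite vals_post.
by apply: eq_nested_pt => // p; rewrite vals_post.
Qed.

Lemma swapw_id J : J a = J b -> swapw i J = J.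
Proof.
move=> e; apply/ffunP => p; rewrite swapwE; have [->|pa] := eqVneq p a; first by rewrite tau_lo.
by have [->|pb] := eqVneq p b; [rewrite tau_hi | rewrite tau_other].
Qed.

Section Generic.
Variables (I J : word n N) (y : 'I_n -> C).
Hypotheses (y_neq0 : forall p, y p != 0) (y_inj : injective y).

Lemma vals_generic k g : g \in pbij I J k -> (J a <= k)%N -> (J b <= k)%N ->
  [/\ vals y g a != 0, vals y g b != 0 & vals y g a != vals y g b].
Proof.
case/pbijP => h1 h2 h3; rewrite -!h1 /vals.
case ga: (g a) => [x|] // _; case gb: (g b) => [x'|] // _; split=> //=.
apply/eqP => /y_inj e; have := h3 a b x ga; rewrite gb e => /(_ erefl)/eqP.
by rewrite -val_eqE /= ltn_eqF.
Qed.

(** The case without an R-matrix: the two letters do not both occur at level k, or they are equal.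
    In the second case the claim is symmetry in [Y a], [Y b]. *)
Lemma nested_swap_sym k Y : ~~ (maxn (J a) (J b) <= k)%N \/ J a = J b ->
  nested I y (swapw i J) k Y = nested I y J k (Y \o s).
Proof.
elim: k Y => //= k IH Y hJ.
have hJ' : ~~ (maxn (J a) (J b) <= k)%N \/ J a = J b.
  by case: hJ => [hJ|]; [left; apply: contra hJ => /leqW | right].
have far : ~~ (maxn (J a) (J b) <= k)%N || (J a != J b) ->
    ~~ ((J a <= k) && (J b <= k.+1))%N /\ ~~ ((J b <= k) && (J a <= k.+1))%N.
  rewrite -val_eqE; move: hJ; rewrite !geq_max => -[|/(congr1 val)] /=.
    move: (val (J a)) (val (J b)) => x x'; lia.
  move: (val (J a)) (val (J b)) => x x'; lia.
case: (boolP (~~ (maxn (J a) (J b) <= k)%N || (J a != J b))) => [/far[f1 f2]|].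
  rewrite big_pbij_pre //; apply: eq_bigr => g _; congr (_ * _).
    rewrite IH //; apply: eq_nested_pt => // p.
    by rewrite /= vals_pre /= tauK.
  rewrite -level_swap_far //; apply: eq_level => // p _; exact: vals_pre.
rewrite negb_or !negbK geq_max => /andP[/andP[ha hb] /eqP eab].
rewrite swapw_id //; rewrite swapw_id // in IH.
(* Equal letters, both present: each sum is added to its image under g -> [pre_tau i g], so that the
   level factor appears symmetrized in X, as [level_both_sym] requires; hence the factor 2. *)
have two0 : (2%:R : C) != 0 by rewrite pnatr_eq0.
apply: (mulfI two0); rewrite ![2%:R * _]mulr_natl !mulr2n.
have dbl Z : \sum_(g in pbij I J k) nested I y J k (vals y g) * level h J k (vals y g) Z =
    \sum_(g in pbij I J k) nested I y J k (vals y g) * level h J k (vals y g \o s) Z.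
  rewrite -{1}(swapw_id eab) big_pbij_pre //; apply: eq_bigr => g _; congr (_ * _).
    rewrite [RHS]IH //; apply: eq_nested_pt => //; exact: vals_pre.
  by apply: eq_level => // p _; apply: vals_pre.
rewrite {2}(dbl Y) {2}(dbl (Y \o s)) -!big_split /=; apply: eq_bigr => g gB.
have [va vb vab] := vals_generic gB ha hb.
by rewrite -!mulrDr level_both_sym.
Qed.

(** At k = J a the letter at a occurs only among the upper variables, and [level_swap_mid] creates
    the relation; every later level passes it on by [level_both_intertwine]. *)
Lemma nested_swap k Y : (J b < J a <= k)%N ->
  (Y b - Y a) * nested I y (swapw i J) k Y =
  (1 - h) * Y b * nested I y J k Y + (h * Y b - Y a) * nested I y J k (Y \o s).
Proof.
elim: k Y => [|k IH] Y /andP[ba ak] /=; first by move: ba ak; case: (val (J a)).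
move: (ak); rewrite leq_eqVlt => /orP[/eqP ak1|ak1].
  rewrite big_pbij_pre // !mulr_sumr -big_split; apply: eq_bigr => g _ /=.
  have -> : nested I y (swapw i J) k (vals y (pre_tau i g)) = nested I y J k (vals y g).
    rewrite nested_swap_sym; last by left; rewrite geq_max ak1 ltnn.
    by apply: eq_nested_pt => // p; rewrite /= vals_pre /= tauK.
  have -> : level h (swapw i J) k (vals y (pre_tau i g)) Y =
            level h (swapw i J) k (vals y g \o s) Y.
    by apply: eq_level => // p _; apply: vals_pre.
  have hb : (J b <= k)%N by rewrite -ltnS -ak1.
  have hak : (k < J a <= k.+1)%N by rewrite ak1 !leqnn.
  have := level_swap_mid h (vals y g) Y hak hb.
  move: (nested _ _ _ _ _) (level _ _ _ _ _) (level _ _ _ _ _) (level _ _ _ _ _).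
  by move=> c l1 l2 l3 e; rewrite mulrCA e; ring.
have ha : (J a <= k)%N by [].
have hb : (J b <= k)%N by apply: leq_trans (ltnW ba) ha.
have eJ m p : (k <= m)%N -> (swapw i J p <= m)%N = (J p <= m)%N.
  by move=> km; apply: (@swapw_le _ _ _ hi); rewrite (leq_trans ha) // (leq_trans hb).
rewrite (eq_pbij I (fun p => eJ k p (leqnn k))).
(* The relation one level down, divided by its left factor, which is nonzero because g and y are
   injective. *)
have IH' g : g \in pbij I J k -> nested I y (swapw i J) k (vals y g) =
    (1 - h) * vals y g b / (vals y g b - vals y g a) * nested I y J k (vals y g)
  + (h * vals y g b - vals y g a) / (vals y g b - vals y g a)
     * nested I y J k (vals y g \o s).
  move=> gB; have [va vb vab] := vals_generic gB ha hb.
  have d0 : vals y g b - vals y g a != 0 by rewrite subr_eq0 eq_sym.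
  rewrite mulrAC [_ / _ * nested _ _ _ _ (_ \o _)]mulrAC -mulrDl -IH ?ba //.
  by rewrite mulrAC mulfV ?mul1r.
rewrite (eq_bigr (fun g =>
    (1 - h) * vals y g b / (vals y g b - vals y g a) * nested I y J k (vals y g)
      * level h J k (vals y g) Y
  + (h * vals y g b - vals y g a) / (vals y g b - vals y g a)
     * nested I y J k (vals y g \o s) * level h J k (vals y g) Y)); last first.
  move=> g gB; rewrite IH' // mulrDl; congr (_ + _); congr (_ * _);
  by apply: eq_level => // p; apply: eJ.
(* Only the second family of terms is reindexed by [pre_tau]; both families then share the factor
   [nested I y J k (vals y g)], and the level identity applies term by term. *)
rewrite big_split /= [X in _ * (_ + X)](_ : _ = \sum_(g in pbij I (swapw i J) k)
    ((h * vals y g b - vals y g a) / (vals y g b - vals y g a)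
     * nested I y J k (vals y g \o s) * level h J k (vals y g) Y)); last first.
  by apply: eq_bigl => g; rewrite (eq_pbij I (fun p => eJ k p (leqnn k))).
rewrite big_pbij_pre // -big_split /= !mulr_sumr -big_split /=; apply: eq_bigr => g gB.
have [va vb vab] := vals_generic gB ha hb.
have -> : nested I y J k (vals y (pre_tau i g) \o s) = nested I y J k (vals y g).
  by apply: eq_nested_pt => // p; rewrite /= vals_pre /= tauK.
have -> : level h J k (vals y (pre_tau i g)) Y = level h J k (vals y g \o s) Y.
  by apply: eq_level => // p _; apply: vals_pre.
rewrite !vals_pre /= tau_lo tau_hi.
have := level_both_intertwine h Y ha hb va vb vab.
move: (level h J k (vals y g) Y) (level h J k (vals y g \o s) Y)
   (level h J k (vals y g) (Y \o s)) => l1 l2 l3 e.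
rewrite [X in (_ - _) * X](_ : _ = nested I y J k (vals y g) *
     ((1 - h) * vals y g b / (vals y g b - vals y g a) * l1 +
      (h * vals y g a - vals y g b) / (vals y g a - vals y g b) * l2)); last by ring.
by rewrite mulrCA e; ring.
Qed.

End Generic.
End NestedSum.

(** * Sums over families of states as iterated sums *)

Section TransferMatrix.
Variables (R : comPzRingType) (A : finType) (S : nat -> pred A) (M : nat -> A -> A -> R).

(** Sums over the states 0, ..., k-1 with state k equal to x; the constraint [S k x] is left to the
    caller. *)
Fixpoint chain k x : R :=
  if k is k'.+1 then \sum_(y | S k' y) chain k' y * M k' y x else 1.

Definition ffun_rcons m (f : {ffun 'I_m -> A}) (x : A) : {ffun 'I_m.+1 -> A} :=
  [ffun j => if unlift ord_max j is Some j' then f j' else x].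

Lemma big_ffun_rcons m (P : pred {ffun 'I_m.+1 -> A}) (G : {ffun 'I_m.+1 -> A} -> R) :
  \sum_(f | P f) G f = \sum_x \sum_(f | P (ffun_rcons f x)) G (ffun_rcons f x).
Proof.
rewrite pair_big_dep /= (reindex (fun u : A * {ffun 'I_m -> A} => ffun_rcons u.2 u.1)) //=.
exists (fun f => (f ord_max, [ffun j => f (lift ord_max j)])) => [[x f]|f] _ /=.
  congr (_, _); first by rewrite ffunE unlift_none.
  by apply/ffunP => j; rewrite !ffunE liftK.
by apply/ffunP => j; rewrite ffunE; case: unliftP => [j' ->|->]; rewrite ?ffunE.
Qed.

Lemma sum_chain m (G : A -> R) :
  \sum_(f : {ffun 'I_m.+1 -> A} | [forall k : 'I_m.+1, S k (f k)])
     (\prod_(k < m) M k (f (inord k)) (f (inord k.+1))) * G (f ord_max)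
  = \sum_(x | S m x) chain m x * G x.
Proof.
elim: m G => [|m IH] G.
  rewrite big_ffun_rcons [RHS]big_mkcond /=; apply: eq_bigr => x _.
  have eP (f : {ffun 'I_0 -> A}) : [forall k : 'I_1, S k (ffun_rcons f x k)] = S 0%N x.
    apply/forallP/idP => [/(_ ord_max)|Sx k]; first by rewrite ffunE unlift_none.
    by rewrite ffunE; case: unliftP => [[]|->].
  rewrite (eq_bigl _ _ eP); case: (S 0%N x); last by rewrite big_pred0.
  rewrite (eq_bigr (fun=> G x)); last first.
    by move=> f _; rewrite big_ord0 mul1r ffunE unlift_none.
  by rewrite sumr_const card_ffun card_ord expn0 mul1r.
rewrite big_ffun_rcons [RHS]big_mkcond /=; apply: eq_bigr => x _.
have eP (f : {ffun 'I_m.+1 -> A}) :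
    [forall k : 'I_m.+2, S k (ffun_rcons f x k)] = [forall k : 'I_m.+1, S k (f k)] && S m.+1 x.
  apply/forallP/andP => [Sf|[/forallP Sf Sx] k]; last first.
    rewrite ffunE; case: unliftP => [j ->|-> //].
    by rewrite lift_max; apply: Sf.
  split; last by have := Sf ord_max; rewrite ffunE unlift_none.
  apply/forallP => k; have := Sf (lift ord_max k).
  by rewrite ffunE liftK lift_max.
rewrite (eq_bigl _ _ eP); case: (S _ x); last first.
  by rewrite big_pred0 // => f; rewrite andbF.
rewrite big_distrl /= (eq_bigr (fun y => chain m y * (M m y x * G x))); last first.
  by move=> y _; rewrite mulrA.
rewrite -(IH (fun y => M m y x * G x)).
apply: eq_big => [f|f _]; first by rewrite andbT.
have em (j : 'I_m.+1) : ffun_rcons f x (inord j) = f j.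
  have -> : inord j = lift ord_max j.
    by apply/ord_inj; rewrite lift_max inordK // ltnS ltnW.
  by rewrite ffunE liftK.
have ex : ffun_rcons f x (inord m.+1) = x.
  have -> : inord m.+1 = ord_max :> 'I_m.+2 by apply/ord_inj; rewrite inordK.
  by rewrite ffunE unlift_none.
have exm : ffun_rcons f x ord_max = x by rewrite ffunE unlift_none.
rewrite big_ord_recr /= ex exm (em ord_max) -mulrA; congr (_ * _).
apply: eq_bigr => k _; congr (M _ _ _).
  by rewrite -em inordK // ltnS ltnW.
by rewrite -em inordK // ltnS.
Qed.

End TransferMatrix.

(** * Ranks of positions within the initial blocks of a word *)

Lemma map_index_iota (T : eqType) (s : seq T) :
  uniq s -> [seq index x s | x <- s] = iota 0 (size s).
Proof.
move=> us; apply: (@eq_from_nth _ 0%N); rewrite ?size_map ?size_iota // => m ms.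
case: s us ms => // x0 s us ms; rewrite (nth_map x0) // nth_iota // add0n.
exact: index_uniq.
Qed.

Section Rank.
Variables (n N : nat) (lam : 'I_N -> nat).
Implicit Types w : word n N.

Definition below w k : seq 'I_n := [seq j <- enum 'I_n | (val (w j) <= k)%N].
Definition rank_in w k (p : 'I_n) : nat := index p (below w k).

Lemma mem_below w k p : (p \in below w k) = (w p <= k)%N.
Proof. by rewrite mem_filter mem_enum andbT. Qed.

Lemma uniq_below w k : uniq (below w k).
Proof. by rewrite filter_uniq ?enum_uniq. Qed.

Lemma size_below w k : inIlam lam w -> size (below w k) = cum lam k.
Proof.
move=> /forallP hw; rewrite size_filter -sum1_count big_enum_cond /=.
rewrite (partition_big (fun j => w j) (fun m : 'I_N => (m <= k)%N)) //=.
apply: eq_bigr => m mk; rewrite -(eqP (hw m)) -sum1_card; apply: eq_bigl => j.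
by rewrite inE andbC; case: eqP => [->|].
Qed.

Lemma size_cumset w k : inIlam lam w -> size (cumset w k) = cum lam k.
Proof. by move=> hw; rewrite size_map size_below. Qed.

Lemma cum_le w k : inIlam lam w -> (cum lam k <= n)%N.
Proof.
move=> hw; rewrite -(size_below k hw) size_filter (leq_trans (count_size _ _)) //.
by rewrite size_enum_ord.
Qed.

Lemma rank_in_lt w k p : inIlam lam w -> (w p <= k)%N -> (rank_in w k p < cum lam k)%N.
Proof. by move=> hw wp; rewrite -(size_below k hw) index_mem mem_below. Qed.

Lemma idx_rank_in w k p : (w p <= k)%N -> idx w k (rank_in w k p) = p.
Proof.
move=> wp; rewrite /idx /rank_in (nth_map p) ?nth_index ?mem_below //.
by rewrite index_mem mem_below.
Qed.

Lemma rank_in_inj w k p q : (w p <= k)%N -> (w q <= k)%N ->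
  rank_in w k p = rank_in w k q -> p = q.
Proof. by move=> wp wq e; apply/val_inj; rewrite /= -(idx_rank_in wp) e idx_rank_in. Qed.

Lemma rank_in_onto w k m : inIlam lam w -> (m < cum lam k)%N ->
  exists2 p, (w p <= k)%N & rank_in w k p = m.
Proof.
move=> hw; rewrite -(size_below k hw) => hm.
case e: (below w k) (hm) => [|x0 l] // _.
exists (nth x0 (below w k) m); first by rewrite -mem_below mem_nth.
by rewrite /rank_in index_uniq ?uniq_below.
Qed.

Lemma sorted_below w k : sorted ltn (map val (below w k)).
Proof.
rewrite sorted_map sorted_filter => [//|x y z /=|]; first exact: ltn_trans.
by rewrite -sorted_map val_enum_ord iota_ltn_sorted.
Qed.

Lemma rank_in_ltn w k p q : (w p <= k)%N -> (w q <= k)%N ->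
  (rank_in w k p < rank_in w k q)%N = (p < q)%N.
Proof.
move=> wp wq.
have mono x y : (w x <= k)%N -> (w y <= k)%N -> (rank_in w k x < rank_in w k y)%N -> (x < y)%N.
  rewrite -!mem_below => hx hy.
  have tr : transitive (relpre val ltn : rel 'I_n) by move=> ? ? ?; apply: ltn_trans.
  have := sorted_below w k; rewrite sorted_map => so.
  exact: (sorted_ltn_index tr so).
apply/idP/idP => [|pq]; first exact: mono.
rewrite ltnNge leq_eqVlt negb_or; apply/andP; split.
  by apply: contraL pq => /eqP /(rank_in_inj wq wp) ->; rewrite ltnn.
by apply: contraL pq => /(mono _ _ wq wp) /ltnW; rewrite leqNgt.
Qed.

Lemma rank_in_top w (p : 'I_n) : rank_in w N.-1 p = p.
Proof.
have -> : rank_in w N.-1 p = index p (enum 'I_n).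
  rewrite /rank_in /below; congr index; apply/all_filterP/allP => j _.
  by rewrite -ltnS (leq_trans (ltn_ord _)) // leqSpred.
by rewrite index_enum_ord.
Qed.

Lemma big_rank_in (R : Type) (x0 : R) (op : Monoid.com_law x0) w k (P : pred nat) (f : nat -> R) :
    inIlam lam w ->
  \big[op/x0]_(c < cum lam k | P c) f c =
  \big[op/x0]_(p | (w p <= k)%N && P (rank_in w k p)) f (rank_in w k p).
Proof.
move=> hw; rewrite -(size_below k hw) -(big_mkord P f) /index_iota subn0.
rewrite -map_index_iota ?uniq_below // big_map /rank_in.
by rewrite {1}/below big_filter_cond big_enum_cond.
Qed.

Lemma card_rank_in w k p : inIlam lam w -> (w p <= k)%N ->
  #|[set c | (w c <= k)%N && (c < p)%N]| = rank_in w k p.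
Proof.
move=> hw wp; rewrite -sum1_card.
transitivity (\sum_(c < cum lam k | (c < rank_in w k p)%N) 1)%N; last first.
  rewrite -(big_ord_widen _ (fun=> 1%N)) ?sum1_card ?card_ord //.
  exact: ltnW (rank_in_lt hw wp).
rewrite (big_rank_in _ _ (fun c => (c < rank_in w k p)%N) (fun=> 1%N) hw).
by apply: eq_bigl => c; rewrite inE; apply: andb_id2l => wc; rewrite rank_in_ltn.
Qed.

End Rank.

(** * Dictionary between permutations of the variables and partial bijections *)

Section LevelBijection.
Variables (n N : nat) (lam : 'I_N -> nat) (I J : word n N).
Hypotheses (hI : inIlam lam I) (hJ : inIlam lam J).

Lemma revw_inIlam : inIlam lam (revw J).
Proof.
apply/forallP => k; rewrite -(eqP (forallP hJ k)) -!sum1_card.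
rewrite [X in _ == X](reindex_inj rev_ord_inj) /=; apply/eqP/eq_bigl => p.
by rewrite !inE ffunE.
Qed.

Definition rev_rank k p := rank_in (revw J) k (rev_ord p).

Lemma revwE p : revw J (rev_ord p) = J p.
Proof. by rewrite ffunE rev_ordK. Qed.

Lemma rev_rank_lt k p : (J p <= k)%N -> (rev_rank k p < cum lam k)%N.
Proof. by move=> Jp; apply: rank_in_lt revw_inIlam _; rewrite revwE. Qed.

Lemma rev_rank_inj k p q : (J p <= k)%N -> (J q <= k)%N -> rev_rank k p = rev_rank k q -> p = q.
Proof. by move=> Jp Jq /rank_in_inj e; apply: rev_ord_inj; apply: e; rewrite revwE. Qed.

Lemma rev_rank_onto k m : (m < cum lam k)%N -> exists2 p, (J p <= k)%N & rev_rank k p = m.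
Proof.
move=> /(rank_in_onto revw_inIlam)[p Jp <-].
by exists (rev_ord p); rewrite /rev_rank ?rev_ordK // -revwE rev_ordK.
Qed.

Variable k : nat.
Local Notation l := (cum lam k).

Definition fixes_above (s : {perm 'I_n}) : bool := [forall j : 'I_n, (l <= j)%N ==> (s j == j)].

(** Two rankings meet: a variable is indexed by the rank of its letter in the reversed word, because
    the weight function is W_(sigma_0,J), while the value substituted for it is indexed by a rank in
    I. *)
Definition pbij_of_perm (s : {perm 'I_n}) : {ffun 'I_n -> option 'I_n} :=
  [ffun p => if (J p <= k)%N then insub (idx I k (applyp s (rev_rank k p))) else None].

Lemma applyp_ord (s : {perm 'I_n}) (j : 'I_n) : applyp s j = s j.
Proof. by rewrite /applyp valK. Qed.

Lemma fixes_above_ge s (j : 'I_n) : fixes_above s -> (l <= j)%N -> s j = j.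
Proof. by move=> /forallP/(_ j)/implyP e /e /eqP. Qed.

Lemma fixes_above_lt s (j : 'I_n) : fixes_above s -> (s j < l)%N = (j < l)%N.
Proof.
move=> fs; rewrite !ltnNge; congr negb; apply/idP/idP => hj.
  by have := fixes_above_ge fs hj => /perm_inj <-.
by rewrite (fixes_above_ge fs hj).
Qed.

Lemma applyp_lt (s : {perm 'I_n}) m : fixes_above s -> (m < l)%N -> (applyp s m < l)%N.
Proof.
move=> fs ml; have mn : (m < n)%N := leq_trans ml (cum_le k hI).
by rewrite -[m]/(val (Ordinal mn)) applyp_ord fixes_above_lt.
Qed.

Lemma applyp_inj (s : {perm 'I_n}) m m' : (m < l)%N -> (m' < l)%N ->
  applyp s m = applyp s m' -> m = m'.
Proof.
move=> ml ml'; have mn := leq_trans ml (cum_le k hI); have mn' := leq_trans ml' (cum_le k hI).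
rewrite -[m]/(val (Ordinal mn)) -[m']/(val (Ordinal mn')) !applyp_ord.
by move=> /val_inj /perm_inj ->.
Qed.

Lemma insub_idx m : (m < l)%N ->
  exists j, [/\ (I j <= k)%N, rank_in I k j = m & insub (idx I k m) = Some j].
Proof. by move=> /(rank_in_onto hI)[j Ij <-]; exists j; rewrite idx_rank_in // valK. Qed.

Lemma pbij_of_permP s : fixes_above s -> pbij_of_perm s \in pbij I J k.
Proof.
move=> fs; have spec p : (J p <= k)%N -> exists j,
    [/\ (I j <= k)%N, rank_in I k j = applyp s (rev_rank k p) & pbij_of_perm s p = Some j].
  move=> Jp; have [j [Ij ej e]] := insub_idx (applyp_lt fs (rev_rank_lt Jp)).
  by exists j; rewrite ffunE Jp.
have dom p j : pbij_of_perm s p = Some j -> (J p <= k)%N by rewrite ffunE; case: ifP.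
apply/pbijP; split=> [p|j|p q j].
- case: (boolP (J p <= k)%N) => [/spec[j [_ _ ->]]//|/negPf Jp].
  by rewrite ffunE Jp.
- split=> [[p gp]|Ij].
    by have [j' [Ij' _]] := spec _ (dom _ _ gp); rewrite gp => -[->].
  have jl : (rank_in I k j < l)%N by apply: rank_in_lt.
  have jn : (rank_in I k j < n)%N := leq_trans jl (cum_le k hI).
  pose o := s^-1%g (Ordinal jn).
  have ol : (o < l)%N by rewrite -(fixes_above_lt _ fs) permKV.
  have [p Jp ep] := rev_rank_onto ol.
  exists p; rewrite ffunE Jp ep applyp_ord permKV /= idx_rank_in //.
  exact: valK.
move=> gp gq; have Jp := dom _ _ gp; have Jq := dom _ _ gq.
have [j1 [Ij1 e1]] := spec _ Jp; rewrite gp => -[e1'].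
have [j2 [Ij2 e2]] := spec _ Jq; rewrite gq => -[e2'].
apply: (rev_rank_inj Jp Jq); apply: (@applyp_inj s); rewrite ?rev_rank_lt //.
by rewrite -e1 -e2 -e1' -e2'.
Qed.

Lemma pbij_of_perm_inj s s' : fixes_above s -> fixes_above s' ->
  pbij_of_perm s = pbij_of_perm s' -> s = s'.
Proof.
move=> fs fs' e; apply/permP => j; case: (leqP l j) => [lj|jl].
  by rewrite !fixes_above_ge.
have [p Jp ep] := rev_rank_onto jl; have := congr1 (fun f : {ffun _ -> _} => f p) e.
rewrite /pbij_of_perm !ffunE Jp ep.
have [x [_ ex ->]] := insub_idx (applyp_lt fs jl).
have [x' [_ ex' ->]] := insub_idx (applyp_lt fs' jl).
by move=> [xx]; apply/val_inj; rewrite /= -!applyp_ord -ex -ex' xx.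
Qed.

Lemma pbij_of_perm_onto g : g \in pbij I J k -> exists2 s, fixes_above s & pbij_of_perm s = g.
Proof.
case/pbijP => h1 h2 h3.
(* Reads the permutation off g: m is the reversed rank of some p, and its image is the rank of g p
   in I; an m that is no such rank is fixed. The defaults for [None] and in [insubd] never occur,
   since J p <= k and ranks stay below n. *)
pose f (m : 'I_n) : 'I_n := if [pick p | (J p <= k)%N && (rev_rank k p == m)] is Some p
  then if g p is Some j then insubd m (rank_in I k j) else m else m.
have f_ge (m : 'I_n) : (l <= m)%N -> f m = m.
  move=> lm; rewrite /f; case: pickP => // p /andP[Jp /eqP e].
  by move: lm; rewrite leqNgt -e rev_rank_lt.
have f_lt p (m : 'I_n) : (J p <= k)%N -> rev_rank k p = m -> exists j,
    [/\ (I j <= k)%N, g p = Some j & (f m : nat) = rank_in I k j].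
  move=> Jp ep; rewrite /f; case: pickP => [q /andP[Jq /eqP eq]|/(_ p)]; last first.
    by rewrite Jp ep eqxx.
  have -> : q = p by apply: (rev_rank_inj Jq Jp); rewrite eq ep.
  have := h1 p; rewrite Jp; case gp: (g p) => [j|] // _.
  have Ij : (I j <= k)%N by apply/h2; exists p.
  exists j; split=> //; rewrite insubdK //.
  by rewrite -topredE /= (leq_trans (rank_in_lt hI Ij) (cum_le k hI)).
have f_lt' (m : 'I_n) : (m < l)%N -> (f m < l)%N.
  move=> /rev_rank_onto[p Jp ep]; have [j [Ij _ ->]] := f_lt p m Jp ep.
  exact: rank_in_lt.
have f_inj : injective f.
  move=> m m' e; case: (leqP l m) => [lm|ml]; case: (leqP l m') => [lm'|ml'].
  - by rewrite -(f_ge _ lm) e f_ge.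
  - by have := f_lt' _ ml'; rewrite -e f_ge // ltnNge lm.
  - by have := f_lt' _ ml; rewrite e f_ge // ltnNge lm'.
  have [p Jp ep] := rev_rank_onto ml; have [p' Jp' ep'] := rev_rank_onto ml'.
  have [j [Ij gj ej]] := f_lt p m Jp ep; have [j' [Ij' gj' ej']] := f_lt p' m' Jp' ep'.
  have ejj : j = j' by apply: (rank_in_inj Ij Ij'); rewrite -ej -ej' e.
  by apply/val_inj; rewrite /= -ep -ep' (h3 p p' j) // ejj.
exists (perm f_inj).
  by apply/forallP => j; apply/implyP => lj; rewrite permE f_ge.
apply/ffunP => p; rewrite ffunE; case: ifP => [Jp|/negP Jp]; last first.
  by have := h1 p; case: (g p) => // j; move/negP: Jp => /negPf ->.
have rl := rev_rank_lt Jp; have rn := leq_trans rl (cum_le k hI).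
have [j [Ij gj ej]] := f_lt p (Ordinal rn) Jp erefl.
rewrite -[rev_rank k p]/(val (Ordinal rn)) applyp_ord permE [val (f _)]ej.
by rewrite gj idx_rank_in // valK.
Qed.

Lemma big_pbij (R : nmodType) (G : {ffun 'I_n -> option 'I_n} -> R) :
  \sum_(s | fixes_above s) G (pbij_of_perm s) = \sum_(g in pbij I J k) G g.
Proof.
have -> : pbij I J k = [set pbij_of_perm s | s in fixes_above].
  apply/setP => g; apply/idP/imsetP => [/pbij_of_perm_onto[s fs <-]|[s fs ->]].
    by exists s.
  exact: pbij_of_permP.
by rewrite big_imset // => s s' /= fs fs'; apply: pbij_of_perm_inj.
Qed.

End LevelBijection.

(** * The symmetrized weight function as a nested sum *)

Lemma level_unfold (C : numClosedFieldType) n N (h : C) (J : word n N) k X Y :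
  level h J k X Y = \prod_(p | (J p <= k)%N)
   ((\prod_(c | (J c <= k.+1)%N && (p < c)%N) (1 - h * Y c / X p))
    * (\prod_(c | (J c <= k.+1)%N && (c < p)%N) (1 - Y c / X p))
    * \prod_(c | (J c <= k)%N && (c < p)%N) ((1 - h * X c / X p) / (1 - X c / X p))).
Proof.
rewrite /level -(pair_big xpredT xpredT (fun p q =>
  cross_factor h J k X Y p q * self_factor h J k X p q)) /=.
rewrite [RHS]big_mkcond; apply: eq_bigr => p _; rewrite /cross_factor /self_factor.
case: (J p <= k)%N; last by rewrite big1 // => q _; rewrite mulr1.
rewrite big_split /=; congr (_ * _); last by rewrite [RHS]big_mkcond.
rewrite [X in _ = X * _]big_mkcond [X in _ = _ * X]big_mkcond -big_split /=.
apply: eq_bigr => q _; case: (J q <= k.+1)%N; last by rewrite mulr1.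
by case: ltngtP => _; rewrite /= ?mulr1 ?mul1r.
Qed.

Section WeightSum.
Variables (C : numClosedFieldType) (n : nat).

Lemma Ufun_levels N (lam : 'I_N -> nat) (J : word n N) T (y : 'I_n -> C) h : inIlam lam J ->
  Ufun lam (revw J) T y h = \prod_(k < N.-1)
    level h J k (fun p => Tv N T y k (rev_rank J k p)) (fun p => Tv N T y k.+1 (rev_rank J k.+1 p)).
Proof.
move=> /revw_inIlam hJ; apply: eq_bigr => k _; rewrite level_unfold.
set Tk := Tv N T y k; set Tk1 := Tv N T y k.+1.
rewrite (@big_rank_in _ _ lam _ _ _ _ k xpredT (fun a =>
   (\prod_(c < cum lam k.+1 | (idx (revw J) k.+1 c < idx (revw J) k a)%N) (1 - h * Tk1 c / Tk a))
   * (\prod_(c < cum lam k.+1 | (idx (revw J) k a < idx (revw J) k.+1 c)%N) (1 - Tk1 c / Tk a))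
   * \prod_(b < cum lam k | (a < b)%N) ((1 - h * Tk b / Tk a) / (1 - Tk b / Tk a))) hJ).
rewrite (reindex_inj rev_ord_inj); apply: eq_big => [p|p /andP[Jp _]].
  by rewrite revwE andbT.
have Jp' := Jp; rewrite revwE in Jp'.
rewrite !idx_rank_in //.
have ltr (a c : 'I_n) : (rev_ord a < rev_ord c)%N = (c < a)%N.
  by rewrite /=; have := ltn_ord a; have := ltn_ord c; lia.
congr (_ * _ * _).
- rewrite (@big_rank_in _ _ lam _ _ _ _ k.+1
    (fun c => (idx (revw J) k.+1 c < rev_ord p)%N)
    (fun c => 1 - h * Tk1 c / Tk (rank_in (revw J) k (rev_ord p))) hJ).
  rewrite (reindex_inj rev_ord_inj); apply: eq_bigl => c.
  by rewrite revwE; apply: andb_id2l => Jc; rewrite idx_rank_in ?revwE // ltr.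
- rewrite (@big_rank_in _ _ lam _ _ _ _ k.+1
    (fun c => (rev_ord p < idx (revw J) k.+1 c)%N)
    (fun c => 1 - Tk1 c / Tk (rank_in (revw J) k (rev_ord p))) hJ).
  rewrite (reindex_inj rev_ord_inj); apply: eq_bigl => c.
  by rewrite revwE; apply: andb_id2l => Jc; rewrite idx_rank_in ?revwE // ltr.
rewrite (@big_rank_in _ _ lam _ _ _ _ k
    (fun b => (rank_in (revw J) k (rev_ord p) < b)%N)
    (fun b => (1 - h * Tk b / Tk (rank_in (revw J) k (rev_ord p)))
      / (1 - Tk b / Tk (rank_in (revw J) k (rev_ord p)))) hJ).
rewrite (reindex_inj rev_ord_inj); apply: eq_bigl => c.
by rewrite revwE; apply: andb_id2l => Jc; rewrite rank_in_ltn ?revwE // ltr.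
Qed.

Variables (m : nat) (lam : 'I_m.+1 -> nat) (I J : word n m.+1) (y : 'I_n -> C) (h : C).
Hypotheses (hI : inIlam lam I) (hJ : inIlam lam J).

(** The case k = m treats the fixed variables z as one more level of the chain, whose permutation
    [S] forces to be the identity. *)
Let V k (s : {perm 'I_n}) (p : 'I_n) : C :=
  if (k < m)%N then zat y (idx I k (applyp s (rev_rank J k p))) else y p.
Let S k (s : {perm 'I_n}) : bool :=
  [forall j : 'I_n, ((k.+1 < m.+1)%N ==> (cum lam k <= j)%N) ==> (s j == j)].

Lemma chain_nested k s : (k <= m)%N ->
  chain S (fun k s s' => level h J k (V k s) (V k.+1 s')) k s = nested h I y J k (V k s).
Proof.
elim: k s => //= k IH s km.
rewrite -(big_pbij hI hJ).
have eS s' : S k s' = fixes_above lam k s'.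
  by apply: eq_forallb => j; rewrite ltnS km.
apply: eq_big => // s' _; rewrite IH ?(ltnW km) //.
have eV p : (J p <= k)%N -> V k s' p = vals y (pbij_of_perm I J k s') p.
  move=> Jp; rewrite /V km /vals /pbij_of_perm ffunE Jp /zat.
  by case: insub.
by congr (_ * _); [apply: eq_nested | apply: eq_level].
Qed.

Lemma sum_Ufun t : (forall k a, t k a = zat y (idx I k a)) ->
  \sum_(f in symfam (n:=n) lam) Ufun lam (revw J) (permt f t) (fun j => y (rev_ord j)) h
  = nested h I y J m y.
Proof.
move=> ht.
have U_V (f : {ffun 'I_m.+1 -> {perm 'I_n}}) :
    Ufun lam (revw J) (permt f t) (fun j => y (rev_ord j)) h
  = (\prod_(k < m) level h J k (V k (f (inord k))) (V k.+1 (f (inord k.+1)))) * 1.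
  rewrite mulr1 Ufun_levels //; apply: eq_bigr => k _.
  have fam k' : (k' < m)%N -> fam_at f k' = f (inord k').
    move=> k'm; rewrite /fam_at insubT => [|k'm1]; first exact: leqW.
    by congr (f _); apply/val_inj; rewrite /= inordK.
  have eV k' p : (k' <= m)%N ->
      Tv m.+1 (permt f t) (fun j => y (rev_ord j)) k' (rev_rank J k' p)
      = V k' (f (inord k')) p.
    move=> k'm; rewrite /Tv /V ltnS; case: ifP => k'm'; first by rewrite /permt ht fam.
    have -> : k' = m by apply/eqP; rewrite eqn_leq k'm leqNgt k'm'.
    by rewrite /rev_rank rank_in_top zat_ord rev_ordK.
  by apply: eq_level => // p _; apply: eV; rewrite // ltnW.
rewrite (eq_bigr _ (fun f _ => U_V f)).
have := @sum_chain _ _ S (fun k s s' => level h J k (V k s) (V k.+1 s')) m (fun=> 1).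
move=> e; rewrite {U_V}[LHS]e.
rewrite (big_pred1 1%g) => [|s] /=.
  rewrite mulr1 chain_nested //; apply: eq_nested_pt => // p; by rewrite /V ltnn.
apply/forallP/eqP => [Ss|-> j]; last by rewrite perm1 eqxx implybT.
by apply/permP => j; have := Ss j; rewrite ltnn /= perm1 => /eqP.
Qed.
End WeightSum.

(** * The exponent p(J) as a number of ascents *)

Section Ascents.
Variables (n N : nat).
Implicit Types J : word n N.

Definition ascents J : nat :=
  (\sum_(pq : 'I_n * 'I_n) ((pq.1 < pq.2) && (J pq.1 < J pq.2)))%N.

(** The order in which the sequence J_N, ..., J_1 lists the positions. *)
Let dec J : rel 'I_n := fun p q => (J q < J p)%N || ((J p == J q) && (p < q)%N).

Lemma dec_trans J : transitive (dec J).
Proof. by move=> q p r; rewrite /dec -!val_eqE /=; lia. Qed.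

Let listing J := flatten [seq [seq j <- enum 'I_n | J j == k] | k <- rev (enum 'I_N)].

Lemma listing_dec J : pairwise (dec J) (listing J).
Proof.
have : pairwise (fun k l : 'I_N => (l < k)%N) (rev (enum 'I_N)).
  rewrite -sorted_pairwise => [|x y z /= xy yz]; last exact: ltn_trans yz xy.
  by rewrite rev_sorted; have := iota_ltn_sorted 0 N; rewrite -val_enum_ord sorted_map.
rewrite /listing; elim: (rev _) => //= k ks IH /andP[/allP hk hks].
rewrite pairwise_cat IH // andbT; apply/andP; split.
  apply/allrelP => p q; rewrite mem_filter => /andP[/eqP Jp _].
  case/flattenP => l /mapP[k' k'ks ->]; rewrite mem_filter => /andP[/eqP Jq _].
  by rewrite /dec Jp Jq hk.
have : pairwise (fun p q : 'I_n => (p < q)%N) [seq j <- enum 'I_n | J j == k].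
  apply: pairwise_filter; rewrite -sorted_pairwise => [|x y z /=]; last exact: ltn_trans.
  by have := iota_ltn_sorted 0 n; rewrite -val_enum_ord sorted_map.
apply: (sub_in_pairwise (P := fun p => J p == k)); last first.
  by apply/allP => p; rewrite mem_filter => /andP[].
by move=> p q /eqP Jp /eqP Jq pq; rewrite /dec Jp Jq eqxx pq orbT.
Qed.

Lemma listing_uniq J : uniq (listing J).
Proof.
apply: (@pairwise_uniq _ (dec J)); last exact: listing_dec.
by move=> p; rewrite /dec !ltnn andbF.
Qed.

Lemma mem_listing J p : p \in listing J.
Proof.
apply/flattenP; exists [seq j <- enum 'I_n | J j == J p].
  by apply/mapP; exists (J p); rewrite ?mem_rev ?mem_enum.
by rewrite mem_filter eqxx mem_enum.
Qed.

Lemma index_listing J p q : p != q ->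
  (index p (listing J) < index q (listing J))%N = dec J p q.
Proof.
move=> npq; have tr := @dec_trans J.
have so : sorted (dec J) (listing J) by rewrite sorted_pairwise // listing_dec.
have lt x y : (index x (listing J) < index y (listing J))%N -> dec J x y.
  by apply: (sorted_ltn_index tr so); rewrite mem_listing.
apply/idP/idP => [/lt //|d]; rewrite ltnNge leq_eqVlt negb_or; apply/andP; split.
  apply: contra npq => /eqP e.
  by rewrite -(nth_index p (mem_listing J p)) -e nth_index ?mem_listing.
apply/negP => /lt; move: d; rewrite /dec -!val_eqE /=; lia.
Qed.

(** Each block is listed increasingly, so a position listed before a smaller one carries a strictly
    larger label. *)
Lemma pinvE J : pinv J = ascents J.
Proof.
have -> : pinv J = inversions (map val (listing J)).
  rewrite /pinv map_flatten -map_comp; congr inversions; congr flatten.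
rewrite /inversions size_map.
have big_listing (F : nat -> nat) :
    (\sum_(x < size (listing J)) F x = \sum_p F (index p (listing J)))%N.
  rewrite -(big_mkord xpredT) /index_iota subn0 -map_index_iota ?listing_uniq //.
  rewrite big_map [LHS]big_uniq ?listing_uniq //=.
  by apply: eq_bigl => p; rewrite mem_listing.
rewrite (big_listing (fun x => \sum_(q < size (listing J))
  ((x < q)%N && (nth 0%N (map val (listing J)) q < nth 0%N (map val (listing J)) x)%N : nat))%N).
have nthE p : nth 0%N (map val (listing J)) (index p (listing J)) = p.
  by rewrite (nth_map p) ?nth_index ?index_mem ?mem_listing.
rewrite /ascents -(pair_big xpredT xpredT (fun p q : 'I_n => ((p < q) && (J p < J q))%N : nat)) /=.
rewrite [RHS]exchange_big; apply: eq_bigr => p _.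
rewrite (big_listing (fun q => ((index p (listing J) < q)%N && (nth 0%N (map val (listing J)) q <
  nth 0%N (map val (listing J)) (index p (listing J)))%N : nat))).
apply: eq_bigr => q _; rewrite !nthE; congr nat_of_bool.
have [->|npq] := eqVneq p q; first by rewrite !ltnn.
by rewrite index_listing // /dec -val_eqE /=; lia.
Qed.

(** Only the pair (a, b) changes status. The increment supplies the extra h in the recursion and
    makes the undoing of descents terminate. *)
Lemma ascents_swap i (hi : (i.+1 < n)%N) J : (J (ord_hi hi) < J (ord_lo hi))%N ->
  ascents (swapw i J) = (ascents J).+1.
Proof.
set a := ord_lo hi; set b := ord_hi hi => Jab.
have nab : (a, b) != (b, a) by rewrite xpair_eqE -!val_eqE /= ltn_eqF.
have s2_inj : injective (fun pq : 'I_n * 'I_n => (tau i pq.1, tau i pq.2)).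
  by move=> [p q] [p' q'] [/(tau_inj hi) -> /(tau_inj hi) ->].
rewrite /ascents (reindex_inj s2_inj) /= (bigD1 (b, a)) //= [X in _ = X.+1](bigD1 (a, b)) //=.
rewrite (bigD1 (a, b)) //= [X in _ = (_ + X)%N.+1](bigD1 (b, a)) /=; last by rewrite eq_sym.
rewrite !swapwE !tauK // /a /b !(tau_lo hi, tau_hi hi) ltnSn Jab.
rewrite [(J (ord_lo hi) < _)%N]ltnNge (ltnW Jab) [(_.+1 < _)%N]ltnNge leqnSn !add0n add1n.
congr S; apply: eq_big => [[p q]|[p q] /andP[h0 h1]] /=; first by rewrite andbC.
by rewrite !swapwE !tauK // tau_ltn.
Qed.

End Ascents.

(** * The explicit formula satisfies the recursion at generic points *)

Section Recursion.
Variables (C : numClosedFieldType) (n i : nat).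
Hypothesis hi : (i.+1 < n)%N.
Local Notation a := (ord_lo hi).
Local Notation b := (ord_hi hi).

(** Since P follows R, coordinate u reads row [swapw i u] of the R-matrix: the diagonal entries
    multiply the coordinate at [swapw i u], with the roles of the two labels exchanged. *)
Lemma stildeE N (f : ('I_n -> C) -> C -> word n N -> C) z h u :
  let x := z a / z b in
  stilde i f z h u =
    if u a == u b then f (swapz i z) h u
    else if (u a < u b)%N then
      h * (1 - x) / (1 - h * x) * f (swapz i z) h (swapw i u)
      + (1 - h) * x / (1 - h * x) * f (swapz i z) h u
    else
      (1 - x) / (1 - h * x) * f (swapz i z) h (swapw i u)
      + (1 - h) / (1 - h * x) * f (swapz i z) h u.
Proof.
move=> x; rewrite /stilde /Pop /Rop.
have -> : zat z i = z a by rewrite -zat_ord.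
have -> : zat z i.+1 = z b by rewrite -zat_ord.
rewrite -/x; move: (f _ h) => g.
have watE (w : word n N) : (wat w i = w a) * (wat w i.+1 = w b).
  by rewrite -!wat_ord.
case: eqVneq => [eab|nab].
  rewrite swapw_id // (bigD1 u) //= big1 => [|w wu].
    by rewrite addr0 /Rcoef eqxx !watE eab eqxx mul1r.
  rewrite /Rcoef eq_sym (negPf wu); case: eqP => [e|]; last by rewrite mul0r.
  by case/eqP: wu; rewrite -[w](swapwK w hi) -e swapw_id.
have nu : swapw i u != u.
  by apply: contra nab => /eqP e; rewrite -{2}e swapwE tau_hi.
rewrite (bigD1 (swapw i u)) //= (bigD1 u) ?(eq_sym u) //= big1 => [|w /andP[w1 w2]].
  rewrite addr0 /Rcoef eqxx (negPf nu) !watE !swapwE tau_lo tau_hi.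
  have -> : (u b == u a :> nat) = false by apply/negbTE; rewrite eq_sym.
  by case: ltngtP => [//|//|/val_inj e]; rewrite e eqxx in nab.
rewrite /Rcoef eq_sym (negPf w1); case: eqP => [e|]; last by rewrite mul0r.
by case/eqP: w2; rewrite -(swapwK w hi) -e swapwK.
Qed.

Variables (m : nat) (lam : 'I_m.+1 -> nat).
Implicit Types (I J : word n m.+1) (z : 'I_n -> C).

(** The part of the formula independent of J. It sees I and z only jointly, so swapping both
    relabels its products ([weight_const_swap]). *)
Definition weight_const I z h : C :=
  (1 - h^-1) ^+ (\sum_(k < m) cum lam k)%N
  / Efun lam (fun k a => (zat z (idx I k a))^-1) h^-1 * Pz I z / Qz I z h.

Lemma zat_inv z q : zat (fun j => (z j)^-1) q = (zat z q)^-1.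
Proof. by rewrite /zat; case: insub => //; rewrite invr0. Qed.

Lemma XformulaE I J z h : inIlam lam I -> inIlam lam J ->
  Xformula lam I J z h = h ^+ pinv J
    * nested h^-1 I (fun j => (z j)^-1) J m (fun j => (z j)^-1) * weight_const I z h.
Proof.
move=> hI hJ; rewrite /Xformula /Wtil_s0 /Wtil /Wfun.
rewrite (sum_Ufun h^-1 hI hJ (y := fun j => (z j)^-1)) => [|k q]; last by rewrite zat_inv.
rewrite /weight_const; move: (nested _ _ _ _ _ _) (Efun _ _ _) (Pz _ _) (Qz _ _ _) => c1 c2 c3 c4.
by rewrite /= !mulrA; congr (_ / _ * _ / _); rewrite -mulrA mulrAC mulrA.
Qed.

Lemma EfunE I z h : inIlam lam I ->
  Efun lam (fun k a => (zat z (idx I k a))^-1) h =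
  \prod_(k < m) \prod_(p | (I p <= k)%N) \prod_(q | (I q <= k)%N) (1 - h * (z q)^-1 / (z p)^-1).
Proof.
move=> hI; rewrite /Efun /=; apply: eq_bigr => k _.
rewrite (@big_rank_in _ _ lam _ _ _ _ k xpredT (fun p => \prod_(q < cum lam k)
  (1 - h * (zat z (idx I k q))^-1 / (zat z (idx I k p))^-1)) hI).
apply: eq_big => [p|p /andP[Ip _]]; first by rewrite andbT.
rewrite (@big_rank_in _ _ lam _ _ _ _ k xpredT (fun q =>
  (1 - h * (zat z (idx I k q))^-1 / (zat z (idx I k (rank_in I k p)))^-1)) hI).
apply: eq_big => [q|q /andP[Iq _]]; first by rewrite andbT.
by rewrite !idx_rank_in // !zat_ord.
Qed.

Lemma weight_const_swap I z h : inIlam lam I ->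
  weight_const (swapw i I) z h = weight_const I (swapz i z) h.
Proof.
move=> hI; rewrite /weight_const !EfunE ?inIlam_swapw // /Pz /Qz /swapz.
congr (_ / _ * _ / _).
- apply: eq_bigr => k _; rewrite (reindex_inj (tau_inj hi)) /=.
  apply: eq_big => [p|p _]; first by rewrite swapwE tauK.
  rewrite (reindex_inj (tau_inj hi)) /=.
  by apply: eq_bigl => q; rewrite swapwE tauK.
- rewrite (reindex_inj (tau_inj hi)) /=; apply: eq_bigr => p _.
  rewrite (reindex_inj (tau_inj hi)) /=.
  by apply: eq_bigl => q; rewrite !swapwE !tauK.
rewrite (reindex_inj (tau_inj hi)) /=; apply: eq_bigr => p _.
rewrite (reindex_inj (tau_inj hi)) /=.
by apply: eq_bigl => q; rewrite !swapwE !tauK.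
Qed.

Definition Xcoef I z h J : C := if inIlam lam J then Xformula lam I J z h else 0.

Lemma Xcoef_swap I z h u : inIlam lam I -> generic z h ->
  Xcoef (swapw i I) z h u = stilde i (Xcoef I) z h u.
Proof.
move=> hI [z0 h0 h1 zz]; rewrite stildeE /Xcoef.
have hsI : inIlam lam (swapw i I) by rewrite inIlam_swapw.
rewrite inIlam_swapw //; case: ifP => hu; last by rewrite !mulr0 addr0 !if_same.
have hsu : inIlam lam (swapw i u) by rewrite inIlam_swapw.
rewrite !XformulaE // weight_const_swap // !nested_swapI //.
set y := (fun j => (z j)^-1); set ys := (fun j => (swapz i z j)^-1).
have y0 p : ys p != 0 by rewrite invr_eq0 z0.
have y_inj : injective ys.
  move=> p q /invr_inj e; apply: (tau_inj hi); apply/eqP.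
  by apply: contraT => /zz /andP[/negP[]]; apply/eqP.
rewrite -/ys; set c := weight_const _ _ _.
have -> : forall J Y, nested h^-1 I (y \o tau i) J m Y = nested h^-1 I ys J m Y by [].
have yss : ys \o tau i =1 y by move=> p; rewrite /ys /swapz /= tauK.
have J_le (J : word n m.+1) p : (J p <= m)%N by rewrite -ltnS.
case: eqVneq => [eab|nab].
  congr (_ * _ * _); rewrite -{1}(swapw_id eab) (nested_swap_sym _ _ y0 y_inj _ (or_intror eab)).
  by [].
have z_ab : z a != z b by have := zz a b; rewrite -val_eqE /= ltn_eqF // => /(_ isT)/andP[].
have z_hab : z b != h * z a.
  by have := zz a b; rewrite -val_eqE /= ltn_eqF // => /(_ isT)/andP[].
have d1 : z b - h * z a != 0 by rewrite subr_eq0.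
have d2 : z a - z b != 0 by rewrite subr_eq0.
have ysab : (ys a = (z b)^-1) * (ys b = (z a)^-1).
  by rewrite /ys /swapz tau_lo tau_hi.
(* A and A' have the top of X_I at the swapped point, B and B' that of X_(s_i I) at z; the prime
   marks the word after the swap. The values [ys] are common to all four, so [nested_swap] with the
   tops [ys] and [y] gives both equations. *)
have main (v : word n m.+1) : (v b < v a)%N -> inIlam lam v ->
  let A := h ^+ pinv v * nested h^-1 I ys v m ys in
  let A' := h ^+ pinv (swapw i v) * nested h^-1 I ys (swapw i v) m ys in
  let B := h ^+ pinv v * nested h^-1 I ys v m y in
  let B' := h ^+ pinv (swapw i v) * nested h^-1 I ys (swapw i v) m y in
  (z b - z a) * A' = (h - 1) * z b * A + (z b - h * z a) * B /\
  (z a - z b) * B' = (h - 1) * z a * B + (z a - h * z b) * A.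
  move=> vba hv /=; rewrite !pinvE (ascents_swap vba) exprS.
  have vm : (v b < v a <= m)%N by rewrite vba J_le.
  have := nested_swap h^-1 I y0 y_inj ys vm.
  have := nested_swap h^-1 I y0 y_inj y vm.
  rewrite (eq_nested_pt h^-1 I v m (frefl ys) yss).
  have -> : nested h^-1 I ys v m (y \o tau i) = nested h^-1 I ys v m ys by [].
  rewrite !ysab.
  move: (nested _ _ _ (swapw _ _) _ y) (nested _ _ _ (swapw _ _) _ ys)
     (nested _ _ _ v _ y) (nested _ _ _ v _ ys) => B' A' B A.
  rewrite /y => e1 e2.
  have za := z0 a; have zb := z0 b.
  have f1 : (z a - z b) * (h * B') = (h - 1) * z a * B + (z a - h * z b) * A.
    transitivity (h * z a * z b * (((z b)^-1 - (z a)^-1) * B')).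
      by field; rewrite za zb.
    by rewrite e1; field; rewrite za zb h0.
  have f2 : (z b - z a) * (h * A') = (h - 1) * z b * A + (z b - h * z a) * B.
    transitivity (h * z a * z b * (((z a)^-1 - (z b)^-1) * A')).
      by field; rewrite za zb.
    by rewrite e2; field; rewrite za zb h0.
  split.
    transitivity (h ^+ ascents v * ((z b - z a) * (h * A'))); first by ring.
    by rewrite f2; ring.
  transitivity (h ^+ ascents v * ((z a - z b) * (h * B'))); first by ring.
  by rewrite f1; ring.
have za := z0 a; have zb := z0 b.
case: (ltngtP (u a) (u b)) => uab; last by case/eqP: nab; apply/val_inj.
  have := main (swapw i u); rewrite !swapwE tau_lo tau_hi swapwK // => /(_ uab hsu)[].
  move: (h ^+ pinv (swapw i u) * nested h^-1 I ys (swapw i u) m ys)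
    (h ^+ pinv u * nested h^-1 I ys u m ys) (h ^+ pinv u * nested h^-1 I ys u m y)
    (h ^+ pinv (swapw i u) * nested h^-1 I ys (swapw i u) m y) => A A' B' B e1 e2.
  apply: (mulfI d2); rewrite [LHS]mulrA e2.
  (* Eliminating B from the pair of equations divides by z b (1 - h x), where 1 - h x is the
     denominator of the R-matrix. *)
  have -> : B = ((z b - z a) * A' - (h - 1) * z b * A) / (z b - h * z a).
    by rewrite e1 addrAC subrr add0r mulrC mulKf.
  by field; rewrite d1 zb.
have [] := main u uab hu.
move: (h ^+ pinv (swapw i u) * nested h^-1 I ys (swapw i u) m ys)
    (h ^+ pinv u * nested h^-1 I ys u m ys) (h ^+ pinv u * nested h^-1 I ys u m y)
    (h ^+ pinv (swapw i u) * nested h^-1 I ys (swapw i u) m y) => A' A B B' e1 _.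
have -> : B = ((z b - z a) * A' - (h - 1) * z b * A) / (z b - h * z a).
  by rewrite e1 addrAC subrr add0r mulrC mulKf.
by field; rewrite d1 zb.
Qed.
End Recursion.

(** * Nonzero terms: triangularity and the diagonal *)

Definition dominating n (g : {ffun 'I_n -> option 'I_n}) : Prop :=
  forall p j, g p = Some j -> (p <= j)%N.

Section Support.
Variables (C : numClosedFieldType) (n N : nat) (h : C) (y : 'I_n -> C).
Hypothesis y_neq0 : forall p, y p != 0.
Implicit Types (I J : word n N) (g : {ffun 'I_n -> option 'I_n}).

(* A letter sent below its position meets a factor [1 - t / t]. *)
Lemma level_dominating I J k g Y :
    (forall j, (I j <= k.+1)%N -> exists c, [/\ (J c <= k.+1)%N, (c <= j)%N & Y c = y j]) ->
    g \in pbij I J k -> level h J k (vals y g) Y != 0 -> dominating g.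
Proof.
move=> cov /pbijP[h1 h2 h3] lv p j gp.
have Ij : (I j <= k)%N by apply/h2; exists p.
have [c [Jc cj Yc]] := cov j (leqW Ij); apply: leq_trans cj; rewrite leqNgt.
apply: contra lv => cp; rewrite /level (bigD1 (p, c)) //= /cross_factor.
have -> : (J p <= k)%N by rewrite -h1 gp.
by rewrite Jc ltnNge (ltnW cp) cp /= Yc /vals gp /= divff // subrr !mul0r.
Qed.

(** A nonzero sum has a nonzero term. A dominating bijection at one level supplies the positions c
    <= j that [level_dominating] needs one level below, so domination descends. *)
Lemma nested_dominating I J k g : g \in pbij I J k -> dominating g ->
    nested h I y J k (vals y g) != 0 ->
  forall k', (k' <= k)%N -> exists2 g', g' \in pbij I J k' & dominating g'.
Proof.
elim: k g => [|k IH] g gB gd nz k'; first by rewrite leqn0 => /eqP ->; exists g.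
rewrite leq_eqVlt => /orP[/eqP ->|]; first by exists g.
rewrite ltnS => k'k; have [g1 /andP[g1B]] : exists g1, (g1 \in pbij I J k) &&
    (nested h I y J k (vals y g1) * level h J k (vals y g1) (vals y g) != 0).
  apply/existsP; apply: contraNT nz; rewrite negb_exists => /forallP e /=.
  by rewrite big1 // => g1 g1B; have := e g1; rewrite g1B negbK => /eqP.
rewrite mulf_eq0 negb_or => /andP[n1 l1]; apply: (IH g1) => //.
apply: (level_dominating _ g1B l1) => j; case/pbijP: gB => h1 h2 _.
move=> /h2[c gc]; exists c; split; last by rewrite /vals gc.
  by rewrite -h1 gc.
exact: gd.
Qed.

(** Counting: let p and q be the entries with 0-based index r of the lists for J and I. If q < p,
    the r + 1 elements of the second list up to q would all be images of the r elements of the first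
    list below p. *)
Lemma dominating_le_cumset lam I J k g : inIlam lam I -> inIlam lam J ->
  g \in pbij I J k -> dominating g -> all2 leq (cumset J k) (cumset I k).
Proof.
move=> hI hJ /pbijP[h1 h2 _] gd.
rewrite all2E !(size_cumset k hI, size_cumset k hJ) eqxx /=.
apply/(all_nthP (0%N, 0%N)) => r; rewrite size_zip !(size_cumset k hI, size_cumset k hJ) minnn.
move=> rl; rewrite nth_zip ?(size_cumset k hI, size_cumset k hJ) //= -/(idx J k r) -/(idx I k r).
have [p Jp ep] := rank_in_onto hJ rl; have [q Iq eq] := rank_in_onto hI rl.
rewrite -{1}ep -{1}eq !idx_rank_in // leqNgt; apply/negP => qp.
have sub : [set j | (I j <= k)%N && (j <= q)%N] \subset
    [set odflt c (g c) | c in [set c | (J c <= k)%N && (c < p)%N]].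
  apply/subsetP => j; rewrite inE => /andP[/h2[c gc] jq]; apply/imsetP; exists c.
    by rewrite inE -h1 gc /= (leq_ltn_trans _ qp) // (leq_trans _ jq) // gd.
  by rewrite gc.
have := leq_trans (subset_leq_card sub) (leq_imset_card _ _).
rewrite (card_rank_in hJ Jp) ep.
have -> : [set j | (I j <= k)%N && (j <= q)%N] = q |: [set j | (I j <= k)%N && (j < q)%N].
  apply/setP => j; rewrite !inE [(j <= q)%N]leq_eqVlt val_eqE.
  by case: eqP => [->|] //=; rewrite Iq.
by rewrite cardsU1 inE ltnn andbF (card_rank_in hI Iq) eq ltnn.
Qed.

(** Induction from the right end: a position moved strictly to the right would land on one that is
    already fixed, against injectivity. *)
Lemma dominating_id I k g : g \in pbij I I k -> dominating g ->
  forall p, (I p <= k)%N -> g p = Some p.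
Proof.
case/pbijP => h1 h2 h3 gd p.
have [d] := ubnP (n - p)%N; elim: d p => // d IH p ltd Ip.
have := h1 p; rewrite Ip; case gp: (g p) => [j|] // _; congr Some.
have := gd _ _ gp; rewrite leq_eqVlt => /orP[/eqP/val_inj -> //|pj].
have gj : g j = Some j.
  apply: IH; last by apply/h2; exists p.
  by have := ltn_ord j; move: ltd pj; lia.
by rewrite (h3 p j j).
Qed.

Lemma nested_diag I k : nested h I y I k y = \prod_(k' < k) level h I k' y y.
Proof.
elim: k => [|k IH] /=; first by rewrite big_ord0.
pose e : {ffun 'I_n -> option 'I_n} := [ffun p => if (I p <= k)%N then Some p else None].
have eB : e \in pbij I I k.
  apply/pbijP; split=> [p|j|p q j]; rewrite ?ffunE; first by case: ifP.
    split=> [[p]|Ij]; last by exists j; rewrite ffunE Ij.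
    by rewrite ffunE; case: ifP => // Ip [<-].
  by case: ifP => // _ [->]; case: ifP => // _ [->].
have eV p : (I p <= k)%N -> vals y e p = y p by move=> Ip; rewrite /vals ffunE Ip.
rewrite (bigD1 e) //= big1 ?addr0 => [|g /andP[gB]].
  rewrite big_ord_recr /= -IH; congr (_ * _); first exact: eq_nested.
  exact: eq_level.
apply: contraNeq; rewrite mulf_eq0 negb_or => /andP[_ lv]; apply/eqP/ffunP => p.
have gd : dominating g by apply: level_dominating gB lv => j Ij; exists j.
rewrite ffunE; case: ifP => [/(dominating_id gB gd) //|/negbT].
by case/pbijP: gB => h1 _ _; rewrite -h1; case: (g p).
Qed.

(** The factors of E with p = q give the power of 1 - h. For labels <= k and q < p, the cross factor
    cancels the denominator of the self factor and leaves the factor of E; for p < q the cross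
    factor already is that factor. Only the q with label k+1 remain. *)
Lemma level_diag lam I k : inIlam lam I -> injective y ->
  (1 - h) ^+ cum lam k * level h I k y y =
  (\prod_(p | (I p <= k)%N) \prod_(q | (I q <= k)%N) (1 - h * y q / y p))
  * \prod_p \prod_q (if (I p <= k)%N && (I q == k.+1 :> nat) then
        (if (p < q)%N then 1 - h * y q / y p else 1 - y q / y p) else 1).
Proof.
move=> hI y_inj.
have -> : (1 - h) ^+ cum lam k =
    \prod_p \prod_q (if (I p <= k)%N && (q == p) then 1 - h else 1).
  transitivity (\prod_(c < cum lam k) (1 - h)); first by rewrite prodr_const card_ord.
  rewrite (@big_rank_in _ _ lam _ _ _ I k xpredT (fun=> 1 - h) hI).
  rewrite big_mkcond; apply: eq_bigr => p _; rewrite andbT -big_mkcond /=.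
  case: (I p <= k)%N => /=; first by rewrite big_pred1_eq.
  by rewrite big_pred0.
have -> : \prod_(p | (I p <= k)%N) \prod_(q | (I q <= k)%N) (1 - h * y q / y p) =
    \prod_p \prod_q (if (I p <= k)%N && (I q <= k)%N then 1 - h * y q / y p else 1).
  rewrite big_mkcond; apply: eq_bigr => p _; case: (I p <= k)%N; first by rewrite big_mkcond.
  by rewrite big1.
rewrite /level -(pair_big xpredT xpredT (fun p q =>
  cross_factor h I k y y p q * self_factor h I k y p q)) /= -!big_split /=.
apply: eq_bigr => p _; rewrite -!big_split /=; apply: eq_bigr => q _.
rewrite /cross_factor /self_factor; case: (leqP (I p) k) => /= Ip; last by rewrite !mulr1.
have [->|nqp] := eqVneq q p.
  by rewrite ltnn andbF Ip (leqW Ip) ltn_eqF // mulfK // !mulr1.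
rewrite mul1r leq_eqVlt ltnS.
case: (ltngtP p q) => [pq|qp|/val_inj e]; last by rewrite e eqxx in nqp.
  rewrite !andbF mulr1; case: (ltngtP (I q) k.+1); rewrite ?ltnS => Iq /=.
  - by rewrite Iq mulr1.
  - by rewrite leqNgt (ltnW Iq) /= mulr1.
  - by rewrite Iq ltnn mul1r.
have d : 1 - y q / y p != 0.
  rewrite subr_eq0 -(inj_eq (mulIf (y_neq0 p))) mul1r divfK // (inj_eq y_inj).
  by rewrite eq_sym.
case: (ltngtP (I q) k.+1); rewrite ?ltnS => Iq /=.
- by rewrite Iq mulr1 mulrC divfK.
- by rewrite leqNgt (ltnW Iq) /= mulr1.
- by rewrite Iq ltnn /= mulr1 mul1r.
Qed.

End Support.

(** * Values of the formula at generic points *)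

Section GenericValues.
Variables (C : numClosedFieldType) (n m : nat) (lam : 'I_m.+1 -> nat).
Implicit Types (I J : word n m.+1) (z : 'I_n -> C).

Lemma Xformula_dominating I J z h : inIlam lam I -> inIlam lam J -> generic z h ->
    Xformula lam I J z h != 0 ->
  forall k, (k <= m)%N -> exists2 g, g \in pbij I J k & dominating g.
Proof.
move=> hI hJ [z0 h0 h1 zz]; rewrite XformulaE // !mulf_eq0 !negb_or => /andP[/andP[_ nz] _].
have J_le (w : word n m.+1) p : (w p <= m)%N by rewrite -ltnS.
(* At the top the variables z are the values of the identity bijection, which dominates; the descent
   starts there. *)
apply: (@nested_dominating _ _ _ h^-1 (fun j => (z j)^-1) _ I J m [ffun p => Some p]).
- by move=> p; rewrite invr_eq0.
- apply/pbijP; split=> [p|j|p q j]; rewrite ?ffunE ?J_le //.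
    by split=> // _; exists j; rewrite ffunE.
  by move=> [->] [->].
- by move=> p j; rewrite ffunE => -[->].
rewrite (eq_nested_pt _ _ _ _ (frefl _) (Y' := fun j => (z j)^-1)) // => p.
by rewrite /vals ffunE.
Qed.

Lemma Xformula_le_id I J z h : inIlam lam I -> inIlam lam J -> generic z h ->
  ~~ le_id J I -> Xformula lam I J z h = 0.
Proof.
move=> hI hJ gz; apply: contraNeq => nz; apply/forallP => k; apply/implyP => km.
have [g gB gd] := Xformula_dominating hI hJ gz nz (leq_ord k).
exact: (dominating_le_cumset hI hJ gB gd).
Qed.

(** A pair with I p < I q is met at exactly one level, k = I q - 1. *)
Lemma prod_label_succ I (F : 'I_n -> 'I_n -> C) :
  \prod_(k < m) \prod_p \prod_q (if (I p <= k)%N && (I q == k.+1 :> nat) then F p q else 1)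
  = \prod_p \prod_(q | (I p < I q)%N) F p q.
Proof.
rewrite exchange_big; apply: eq_bigr => p _; rewrite exchange_big [RHS]big_mkcond.
apply: eq_bigr => q _ /=; case Iq: (I q : nat) => [|k0].
  by rewrite big1 // => k _; rewrite andbF.
have k0m : (k0 < m)%N by have := ltn_ord (I q); rewrite Iq.
rewrite (bigD1 (Ordinal k0m)) //= eqxx andbT ltnS big1 ?mulr1 // => k.
by rewrite -val_eqE eqSS [k0 == _]eq_sym => /negPf ->; rewrite andbF.
Qed.

(** By [level_diag], E and the power of 1 - h^-1 cancel. Let I p < I q. If p < q, one h from h^p(I)
    gives h (1 - h^-1 z_p/z_q) (-z_q/z_p) = 1 - h z_q/z_p, which cancels against Q; if q < p, the
    factor of P turns 1 - z_p/z_q into 1 - z_q/z_p. *)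
Lemma Xformula_diag I z h : inIlam lam I -> generic z h -> Xformula lam I I z h = Xdiag I z h.
Proof.
move=> hI [z0 h0 h1 zz]; pose y j := (z j)^-1.
have y0 p : y p != 0 by rewrite invr_eq0.
have y_inj : injective y.
  by move=> p q /invr_inj e; apply/eqP; apply: contraT => /zz; rewrite e eqxx.
have E0 k : \prod_(p | (I p <= k)%N) \prod_(q | (I q <= k)%N) (1 - h^-1 * y q / y p) != 0.
  apply/prodf_neq0 => p _; apply/prodf_neq0 => q _; rewrite subr_eq0 eq_sym /y invrK.
  have [->|qp] := eqVneq q p; first by rewrite divfK // invr_eq1.
  apply: contraNneq (proj2 (andP (zz q p qp))) => e.
  have -> : z p = h * z q * (h^-1 / z q * z p) by field; rewrite h0 z0.
  by rewrite e mulr1.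
rewrite XformulaE // pinvE nested_diag // /weight_const EfunE // [(1 - h^-1) ^+ _]expr_sum.
have -> : \prod_(k < m) level h^-1 I k y y = (\prod_(k < m) (1 - h^-1) ^+ cum lam k)^-1
   * (\prod_(k < m) \prod_(p | (I p <= k)%N) \prod_(q | (I q <= k)%N) (1 - h^-1 * y q / y p))
   * \prod_p \prod_(q | (I p < I q)%N)
      (if (p < q)%N then 1 - h^-1 * y q / y p else 1 - y q / y p).
  rewrite -(prod_label_succ I (fun p q =>
    if (p < q)%N then 1 - h^-1 * y q / y p else 1 - y q / y p)).
  rewrite -prodfV -!big_split /=; apply: eq_bigr => k _.
  rewrite -mulrA -(level_diag _ _ _ hI) // mulKf // expf_neq0 // subr_eq0 eq_sym.
  by rewrite invr_eq1.
set e1 := \prod_(k < m) _ ^+ _; set e2 := \prod_(k < m) \prod_(p | _) _.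
have e10 : e1 != 0.
  by apply/prodf_neq0 => k _; rewrite expf_neq0 // subr_eq0 eq_sym invr_eq1.
have e20 : e2 != 0 by apply/prodf_neq0 => k _; apply: E0.
transitivity (h ^+ ascents I * (\prod_p \prod_(q | (I p < I q)%N)
      (if (p < q)%N then 1 - h^-1 * y q / y p else 1 - y q / y p)) * (Pz I z / Qz I z h)).
  move: (\prod_p _) (Pz I z) (Qz I z h)^-1 => c1 c2 c3; rewrite -/e2.
  by field; rewrite e10 e20.
have -> : h ^+ ascents I = \prod_p \prod_(q | (I p < I q)%N) (if (p < q)%N then h else 1).
  rewrite /ascents expr_sum -(pair_big xpredT xpredT (fun p q : 'I_n =>
    h ^+ ((p < q) && (I p < I q))%N)) /=.
  apply: eq_bigr => p _; rewrite [RHS]big_mkcond; apply: eq_bigr => q _.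
  by case: (p < q)%N; case: (I p < I q)%N.
rewrite /Pz /Qz -prodfV -!big_split /=; apply: eq_bigr => p _.
rewrite -prodfV -!big_split /= [RHS]big_mkcondr /=; apply: eq_bigr => q Ipq.
have d : z p - h * z q != 0.
  have qp : q != p by apply: contraTneq Ipq => ->; rewrite ltnn.
  by rewrite subr_eq0; have /andP[] := zz q p qp.
have zp := z0 p; have zq := z0 q.
case: (ltngtP p q) => [pq|qp|/val_inj e]; last by rewrite e ltnn in Ipq.
  by rewrite /y; field; rewrite zp zq h0 d.
by rewrite /y; field; rewrite zp zq d.
Qed.

End GenericValues.

(** * The minimal word as the unique weakly increasing one *)

Section MinimalWord.
Variables (n N : nat) (lam : 'I_N -> nat) (hN : (0 < N)%N).
Hypothesis hlam : (\sum_(k < N) lam k)%N = n.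

Lemma cumS k : cum lam k = cumb lam k.+1.
Proof. by []. Qed.

Lemma cumb_mono k l : (k <= l)%N -> (cumb lam k <= cumb lam l)%N.
Proof.
move=> kl; rewrite /cumb [leqRHS](bigID (fun x : 'I_N => (x < k)%N)) /=.
apply: leq_trans (leq_addr _ _); apply: eq_leq; apply: eq_bigl => x.
by apply/idP/andP => [xk|[]//]; split=> //; apply: leq_trans kl.
Qed.

(** The default in [Imin] is never taken: the partial sums reach n, and the least one exceeding j
    locates its block. *)
Lemma Imin_bounds (j : 'I_n) : let k := Imin lam hN j in (cumb lam k <= j < cum lam k)%N.
Proof.
rewrite /= ffunE; case: pickP => //= none.
have ex : exists k, (j < cumb lam k)%N.
  exists N; rewrite /cumb (eq_bigl xpredT) ?hlam // => x; exact: ltn_ord.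
case: (ex_minnP ex) => -[|k] hk mink; first by move: hk; rewrite /cumb big_pred0.
have kN : (k < N)%N.
  rewrite ltnNge; apply/negP => Nk.
  have := mink k; rewrite ltnn => /(_ _)/negP[]; rewrite ?negbK //.
  apply: leq_trans hk _; rewrite /cumb; apply: eq_leq; apply: eq_bigl => x.
  by rewrite !(leq_trans (ltn_ord x)) // leqW.
have := none (Ordinal kN); rewrite /= cumS hk andbT => /negbT; rewrite -ltnNge => /mink.
by rewrite ltnn.
Qed.

Lemma Imin_eq (j : 'I_n) (k : 'I_N) : (Imin lam hN j == k) = (cumb lam k <= j < cum lam k)%N.
Proof.
apply/eqP/idP => [<-|/andP[l1 l2]]; first exact: Imin_bounds.
have /andP[b1 b2] := Imin_bounds j; apply/val_inj => /=.
case: (ltngtP (Imin lam hN j) k) => // lt.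
  by have := leq_trans b2 (leq_trans (cumb_mono lt) l1); rewrite ltnn.
by have := leq_trans l2 (leq_trans (cumb_mono lt) b1); rewrite ltnn.
Qed.

Lemma Imin_mono (j j' : 'I_n) : (j <= j')%N -> (Imin lam hN j <= Imin lam hN j')%N.
Proof.
move=> jj'; rewrite leqNgt; apply/negP => lt.
have /andP[b1 _] := Imin_bounds j; have /andP[_ b2] := Imin_bounds j'.
by have := leq_trans b2 (leq_trans (cumb_mono lt) (leq_trans b1 jj')); rewrite ltnn.
Qed.

Lemma Imin_inIlam : inIlam lam (Imin lam hN : word n N).
Proof.
apply/forallP => k; rewrite -sum1_card (eq_bigl _ _ (fun j => Imin_eq j k)).
have cn : (cum lam k <= n)%N.
  rewrite cumS -hlam; apply: (leq_trans (cumb_mono (ltn_ord k))).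
  by rewrite /cumb big_mkcond leq_sum // => x _; case: ifP.
rewrite -(big_mkord (fun j => (cumb lam k <= j < cum lam k)%N) (fun=> 1%N)).
rewrite -(big_nat_widen _ _ _ (fun j => (cumb lam k <= j)%N)) //.
rewrite (eq_bigl (fun j => true && (cumb lam k <= j)%N)) // -big_nat_widenl //.
rewrite sum_nat_const_nat muln1 cumS /cumb.
rewrite [X in (X - _)%N](bigID (fun x : 'I_N => (x < k)%N)) /=.
rewrite (eq_bigl (fun x : 'I_N => (x < k)%N)) => [|x]; last first.
  by apply/andP/idP => [[]//|xk]; split=> //; apply: leqW.
rewrite addKn (big_pred1 k) // => x.
by rewrite ltnS -leqNgt -eqn_leq.
Qed.

Lemma word_eq_le (w w' : word n N) :
  (forall j k, (w j <= k)%N = (w' j <= k)%N) -> w = w'.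
Proof.
move=> e; apply/ffunP => j; apply/val_inj/eqP.
by rewrite eqn_leq e leqnn -e leqnn.
Qed.

Lemma mono_word_le (w : word n N) : inIlam lam w ->
    (forall j j' : 'I_n, (j <= j')%N -> (w j <= w j')%N) ->
  forall j k, (w j <= k)%N = (j < cum lam k)%N.
Proof.
move=> hw mono; have rk k j : (w j <= k)%N -> rank_in w k j = j.
  move=> wj; rewrite -(card_rank_in hw wj) -sum1_card.
  transitivity (\sum_(c < n | (c < j)%N) 1)%N.
    apply: eq_bigl => c; rewrite inE; apply: andb_idl => cj.
    by apply: leq_trans wj; apply: mono; apply: ltnW.
  by rewrite -(big_ord_widen _ (fun=> 1%N)) ?sum1_card ?card_ord // ltnW.
move=> j k; apply/idP/idP => [wj|jk]; first by rewrite -{1}(rk _ _ wj) rank_in_lt.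
have [p wp ep] := rank_in_onto hw jk.
by have -> : j = p by apply/val_inj; rewrite /= -ep rk.
Qed.

Lemma sorted_word_Imin (w : word n N) : inIlam lam w ->
    (forall i (hi : (i.+1 < n)%N), (w (ord_lo hi) <= w (ord_hi hi))%N) ->
  w = Imin lam hN.
Proof.
move=> hw asc; apply: word_eq_le => j k; rewrite !mono_word_le ?Imin_inIlam //.
  exact: Imin_mono.
move=> x y; have [d] := ubnPleq (y - x)%N; elim: d x y => [|d IH] x y dxy xy.
  by have -> : x = y by apply/val_inj/eqP; rewrite /= eqn_leq xy -subn_eq0 -leqn0.
move: xy; rewrite leq_eqVlt => /orP[/eqP/val_inj -> //|xy].
have hi : (x.+1 < n)%N := leq_ltn_trans xy (ltn_ord y).
have -> : x = ord_lo hi by apply/val_inj.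
apply: leq_trans (asc x hi) _; apply: IH => //=.
by rewrite -ltnS (leq_trans _ dxy) // subnS prednK // subn_gt0.
Qed.

(** Taking k = J p, domination and monotonicity give Imin p <= Imin (g p) <= J p. So {J <= k} is
    contained in {Imin <= k}, and both have the same cardinality. *)
Lemma dominating_Imin (J : word n N) : inIlam lam J ->
    (forall k, (k < N)%N -> exists2 g, g \in pbij (Imin lam hN) J k & dominating g) ->
  J = Imin lam hN.
Proof.
move=> hJ dom; have hm := Imin_inIlam.
have le p : (Imin lam hN p <= J p)%N.
  have [g /pbijP[h1 h2 _] gd] := dom _ (ltn_ord (J p)).
  have := h1 p; rewrite leqnn; case gp: (g p) => [j|] // _.
  apply: (leq_trans (Imin_mono (gd _ _ gp))).
  by apply/h2; exists p.
apply: word_eq_le => j k.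
have card w : inIlam lam w -> #|[set p : 'I_n | (w p <= k)%N]| = cum lam k.
  move=> hw; rewrite -(size_below k hw) -sum1_card size_filter -sum1_count big_enum_cond.
  by apply: eq_bigl => p; rewrite inE.
have /eqP e : [set p | (J p <= k)%N] == [set p | (Imin lam hN p <= k)%N].
  rewrite eqEcard !card // leqnn andbT; apply/subsetP => p; rewrite !inE.
  exact: leq_trans.
by have := congr1 (fun A : {set _} => j \in A) e; rewrite !inE.
Qed.

End MinimalWord.

(** * Laurent polynomials and their localizations as functions *)

Section Laurent.
Variables (C : numClosedFieldType) (n : nat).
Implicit Types (z : 'I_n -> C) (h : C) (f g d : ('I_n -> C) -> C -> C).

Definition torus z h : Prop := (forall j, z j != 0) /\ h != 0.

Definition laurent f : Prop := exists s, forall z h, torus z h -> f z h = lpoly s z h.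

Lemma eq_laurent f g : (forall z h, torus z h -> f z h = g z h) -> laurent g -> laurent f.
Proof. by move=> e [s hs]; exists s => z h zh; rewrite e ?hs. Qed.

Lemma laurent_monomial c (k : int) (e : {ffun 'I_n -> int}) :
  laurent (fun z h => c * (h ^ k * \prod_(j < n) z j ^ e j)).
Proof. by exists [:: (c, (k, e))] => z h _; rewrite /lpoly big_seq1. Qed.

Lemma laurent_cst c : laurent (fun _ _ => c).
Proof.
apply: eq_laurent (laurent_monomial c 0 [ffun=> 0]) => z h _.
by rewrite expr0z mul1r big1 ?mulr1 // => j _; rewrite ffunE expr0z.
Qed.

Lemma laurent_h : laurent (fun _ h => h).
Proof.
apply: eq_laurent (laurent_monomial 1 1 [ffun=> 0]) => z h _.
by rewrite expr1z mul1r big1 ?mulr1 // => j _; rewrite ffunE expr0z.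
Qed.

Lemma laurent_zX p (k : int) : laurent (fun z _ => z p ^ k).
Proof.
apply: eq_laurent (laurent_monomial 1 0 [ffun j => if j == p then k else 0]) => z h _.
rewrite expr0z !mul1r (bigD1 p) //= ffunE eqxx big1 ?mulr1 // => j /negPf jp.
by rewrite ffunE jp expr0z.
Qed.

Lemma laurentD f g : laurent f -> laurent g -> laurent (fun z h => f z h + g z h).
Proof.
by move=> [s hs] [s' hs']; exists (s ++ s') => z h zh; rewrite hs ?hs' // /lpoly big_cat.
Qed.

Definition mul_term (t t' : C * (int * {ffun 'I_n -> int})) : C * (int * {ffun 'I_n -> int}) :=
  (t.1 * t'.1, (t.2.1 + t'.2.1, [ffun j => t.2.2 j + t'.2.2 j])).

Lemma laurentM f g : laurent f -> laurent g -> laurent (fun z h => f z h * g z h).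
Proof.
move=> [s hs] [s' hs'].
exists [seq mul_term t t' | t <- s, t' <- s'].
move=> z h [z0 h0]; rewrite hs ?hs' // /lpoly big_allpairs_dep big_distrlr /=.
apply: eq_bigr => t _; apply: eq_bigr => t' _.
have -> : \prod_(j < n) z j ^ (mul_term t t').2.2 j =
    (\prod_(j < n) z j ^ t.2.2 j) * \prod_(j < n) z j ^ t'.2.2 j.
  by rewrite -big_split; apply: eq_bigr => j _; rewrite ffunE expfzDr.
by rewrite /= expfzDr //; ring.
Qed.

Lemma laurentN f : laurent f -> laurent (fun z h => - f z h).
Proof.
move=> lf; apply: eq_laurent (laurentM (laurent_cst (-1)) lf) => z h _.
by rewrite mulN1r.
Qed.

Lemma laurentX f k : laurent f -> laurent (fun z h => f z h ^+ k).
Proof.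
move=> lf; elim: k => [|k IH]; first exact: laurent_cst.
by apply: eq_laurent (laurentM lf IH) => z h _; rewrite exprS.
Qed.

Lemma laurent_prod (T : Type) (r : seq T) (P : pred T) (F : T -> ('I_n -> C) -> C -> C) :
  (forall x, P x -> laurent (F x)) -> laurent (fun z h => \prod_(x <- r | P x) F x z h).
Proof.
move=> lF; elim: r => [|x r IH].
  by apply: eq_laurent (laurent_cst 1) => z h _; rewrite big_nil.
case Px: (P x).
  by apply: eq_laurent (laurentM (lF x Px) IH) => z h _; rewrite big_cons Px.
by apply: eq_laurent IH => z h _; rewrite big_cons Px.
Qed.

Lemma laurent_ratio p q : laurent (fun z _ => z q / z p).
Proof.
apply: eq_laurent (laurentM (laurent_zX q 1) (laurent_zX p (-1))) => z h _.
by rewrite expr1z exprN1.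
Qed.

Lemma laurent_factor p q : laurent (fun z h => 1 - h * z q / z p).
Proof.
apply: eq_laurent (laurentD (laurent_cst 1)
  (laurentN (laurentM laurent_h (laurent_ratio p q)))) => z h _.
by rewrite mulrA.
Qed.

Section Swap.
Variable i : nat.
Hypothesis hi : (i.+1 < n)%N.

Lemma torus_swapz z h : torus z h -> torus (swapz i z) h.
Proof. by move=> [z0 h0]; split=> // j; apply: z0. Qed.

Lemma laurent_swapz f : laurent f -> laurent (fun z h => f (swapz i z) h).
Proof.
move=> [s hs]; pose st (t : C * (int * {ffun 'I_n -> int})) : C * (int * {ffun 'I_n -> int}) :=
  (t.1, (t.2.1, [ffun j => t.2.2 (tau i j)])).
exists [seq st t | t <- s] => z h zh.
rewrite hs; last exact: torus_swapz.
rewrite /lpoly big_map /=; apply: eq_bigr => t _; congr (_ * (_ * _)).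
rewrite (reindex_inj (tau_inj hi)) /=; apply: eq_bigr => j _.
by rewrite ffunE /swapz tauK.
Qed.

End Swap.

(** Regularity with any denominator d in place of D; it is used for [inv_denom I], for single
    factors and for D(z) D(s_i z). *)
Definition reg_on d f : Prop := exists g k, laurent g /\
  forall z h, torus z h -> d z h != 0 -> f z h = g z h / d z h ^+ k.

Lemma eq_reg_on d f g : (forall z h, torus z h -> d z h != 0 -> f z h = g z h) ->
  reg_on d g -> reg_on d f.
Proof. by move=> e [g' [k [lg' hg']]]; exists g', k; split=> // z h zh dz; rewrite e ?hg'. Qed.

Lemma reg_on_laurent d f : laurent f -> reg_on d f.
Proof. by move=> lf; exists f, 0%N; split=> // z h _ _; rewrite expr0 divr1. Qed.

Lemma reg_onV d : reg_on d (fun z h => (d z h)^-1).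
Proof.
exists (fun _ _ => 1), 1%N; split; first exact: laurent_cst.
by move=> z h _ _; rewrite expr1 mul1r.
Qed.

Lemma reg_onM d f g : reg_on d f -> reg_on d g -> reg_on d (fun z h => f z h * g z h).
Proof.
move=> [f' [k [lf hf]]] [g' [l [lg hg]]]; exists (fun z h => f' z h * g' z h), (k + l)%N.
split=> [|z h zh dz]; first exact: laurentM.
by rewrite hf ?hg // exprD invfM mulrACA.
Qed.

Lemma reg_onD d f g : laurent d -> reg_on d f -> reg_on d g ->
  reg_on d (fun z h => f z h + g z h).
Proof.
move=> ld [f' [k [lf hf]]] [g' [l [lg hg]]].
exists (fun z h => f' z h * d z h ^+ l + g' z h * d z h ^+ k), (k + l)%N; split=> [|z h zh dz].
  by apply: laurentD; apply: laurentM => //; apply: laurentX.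
rewrite hf ?hg // exprD; field; by rewrite !expf_neq0.
Qed.

Lemma reg_on_prod d (T : Type) (r : seq T) (P : pred T) (F : T -> ('I_n -> C) -> C -> C) :
  (forall x, P x -> reg_on d (F x)) -> reg_on d (fun z h => \prod_(x <- r | P x) F x z h).
Proof.
move=> lF; elim: r => [|x r IH].
  by apply: eq_reg_on (reg_on_laurent d (laurent_cst 1)) => z h _ _; rewrite big_nil.
case Px: (P x).
  by apply: eq_reg_on (reg_onM (lF x Px) IH) => z h _ _; rewrite big_cons Px.
by apply: eq_reg_on IH => z h _ _; rewrite big_cons Px.
Qed.

Lemma reg_on_dvd d e d' f : laurent e ->
  (forall z h, torus z h -> d' z h = d z h * e z h) -> reg_on d f -> reg_on d' f.
Proof.
move=> le ed [g [k [lg hg]]]; exists (fun z h => g z h * e z h ^+ k), k; split=> [|z h zh].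
  by apply: laurentM => //; apply: laurentX.
rewrite ed // mulf_eq0 negb_or => /andP[dz ez]; rewrite hg // exprMn; field.
by rewrite !expf_neq0.
Qed.

Lemma reg_on_swapz i d f : (i.+1 < n)%N -> reg_on d f ->
  reg_on (fun z h => d (swapz i z) h) (fun z h => f (swapz i z) h).
Proof.
move=> hi [g [k [lg hg]]]; exists (fun z h => g (swapz i z) h), k.
split=> [|z h zh dz]; first exact: laurent_swapz.
by rewrite hg //; apply: torus_swapz.
Qed.

Lemma inUP z h : inU z h <-> torus z h /\ Dfun z h != 0.
Proof. by split=> [[z0 h0 D0]|[[z0 h0] D0]]; split. Qed.

Lemma regularP f : regular f <-> reg_on Dfun f.
Proof.
split=> [[s [k e]]|[g [k [[s hs] e]]]].
  exists (lpoly s), k; split=> [|z h zh dz]; first by exists s.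
  by apply: e; apply/inUP.
by exists s, k => z h /inUP[zh dz]; rewrite e // hs.
Qed.

End Laurent.

(** * Identities at generic points extend to regular points *)

Section Density.
Variables (C : numClosedFieldType) (n : nat).

Lemma poly_vanish (p : {poly C}) : (forall t, p.[t] = 0) -> p = 0.
Proof.
move=> p0; apply/eqP; apply: contraT => nz.
have := max_poly_roots nz (rs := [seq k%:R | k <- iota 0 (size p)]).
rewrite size_map size_iota ltnn => -> //.
  by apply/allP => x _; rewrite /root p0.
by rewrite map_inj_uniq ?iota_uniq // => k l /eqP; rewrite eqr_nat => /eqP.
Qed.

Definition poly_quot (d : {poly C}) (f : C -> C) : Prop :=
  exists k q, forall t, d.[t] != 0 -> f t * d.[t] ^+ k = q.[t].

Lemma eq_poly_quot d f g : (forall t, d.[t] != 0 -> f t = g t) -> poly_quot d g -> poly_quot d f.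
Proof. by move=> e [k [q hq]]; exists k, q => t dt; rewrite e ?hq. Qed.

Lemma poly_quot_horner d p : poly_quot d (horner p).
Proof. by exists 0%N, p => t _; rewrite expr0 mulr1. Qed.

Lemma poly_quotD d f g : poly_quot d f -> poly_quot d g -> poly_quot d (fun t => f t + g t).
Proof.
move=> [k [q hq]] [l [r hr]]; exists (k + l)%N, (q * d ^+ l + r * d ^+ k) => t dt.
rewrite hornerD !hornerM !horner_exp -hq // -hr // exprD; ring.
Qed.

Lemma poly_quotM d f g : poly_quot d f -> poly_quot d g -> poly_quot d (fun t => f t * g t).
Proof.
move=> [k [q hq]] [l [r hr]]; exists (k + l)%N, (q * r) => t dt.
by rewrite hornerM -hq // -hr // exprD mulrACA.
Qed.

Lemma poly_quotX d f k : poly_quot d f -> poly_quot d (fun t => f t ^+ k).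
Proof.
move=> lf; elim: k => [|k IH].
  by apply: eq_poly_quot (poly_quot_horner d 1) => t _; rewrite expr0 hornerC.
by apply: eq_poly_quot (poly_quotM lf IH) => t _; rewrite exprS.
Qed.

(** Negative powers use 1/p = r/(p r). *)
Lemma poly_quot_exprz p r (k : int) : poly_quot (p * r) (fun t => p.[t] ^ k).
Proof.
case: k => k; first exact: (poly_quotX k (poly_quot_horner _ _)).
have qV : poly_quot (p * r) (fun t => p.[t]^-1).
  exists 1%N, r => t; rewrite hornerM mulf_eq0 negb_or => /andP[pt rt].
  by rewrite expr1 mulKf.
by apply: eq_poly_quot (poly_quotX k.+1 qV) => t _; rewrite NegzE exprVn.
Qed.

Lemma generic_point : exists (z : 'I_n -> C) h, generic z h.
Proof.
(* Parity excludes 3^b = 2 * 3^a. *)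
exists (fun j => (3 ^ j)%:R), 2%:R; split.
- by move=> j; rewrite pnatr_eq0 expn_eq0.
- by rewrite pnatr_eq0.
- by rewrite (eqr_nat _ 2 1).
move=> a b ab; rewrite -natrM !eqr_nat eqn_exp2l // ab /=.
by apply/eqP => /(congr1 odd); rewrite oddM !oddX /= !orbT.
Qed.

Definition generic_poly (zl : 'I_n -> {poly C}) (hl : {poly C}) : {poly C} :=
  hl * \prod_j zl j * (hl - 1) *
  \prod_(ab : 'I_n * 'I_n | ab.1 != ab.2) ((zl ab.1 - zl ab.2) * (zl ab.2 - hl * zl ab.1)).

Lemma generic_polyP zl hl t :
  (generic_poly zl hl).[t] != 0 <-> generic (fun j => (zl j).[t]) hl.[t].
Proof.
rewrite /generic_poly !hornerM !horner_prod hornerD hornerN hornerC !mulf_eq0 !negb_or subr_eq0.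
have pair_neq0 (a b : 'I_n) :
    (((zl a - zl b) * (zl b - hl * zl a)).[t] != 0)
    = ((zl a).[t] != (zl b).[t]) && ((zl b).[t] != hl.[t] * (zl a).[t]).
  by rewrite hornerM mulf_eq0 negb_or !hornerD !hornerN hornerM !subr_eq0.
split=> [/andP[/andP[/andP[ht /prodf_neq0 zt] h1t] /prodf_neq0 ab]|[zt ht h1t ab]].
  split=> // [j|a b nab]; first exact: zt.
  by rewrite -pair_neq0; apply: (ab (a, b)).
rewrite ht h1t /= andbT; apply/andP; split; apply/prodf_neq0 => // -[a b] /= nab.
by rewrite pair_neq0; apply: ab.
Qed.

(* Restrict to the line through the given point and a generic point. *)
Lemma laurent_density (f : ('I_n -> C) -> C -> C) : laurent f ->
  (forall z h, generic z h -> f z h = 0) -> forall z h, torus z h -> f z h = 0.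
Proof.
move=> [s hs] f0 z h zh; rewrite hs //; case: zh => z0 h0.
have {f0 hs} f0 z' h' : generic z' h' -> lpoly s z' h' = 0.
  by move=> gz; rewrite -hs ?f0 //; case: gz.
have [w [h1 [w0 h10 h11 ww]]] := generic_point.
pose zl j : {poly C} := (z j)%:P + (w j - z j) *: 'X.
pose hl : {poly C} := h%:P + (h1 - h) *: 'X.
pose d := hl * \prod_j zl j.
have zlE j t : (zl j).[t] = z j + (w j - z j) * t by rewrite !hornerE.
have hlE t : hl.[t] = h + (h1 - h) * t by rewrite !hornerE.
have dE t : d.[t] != 0 -> torus (fun j => (zl j).[t]) hl.[t].
  rewrite hornerM horner_prod mulf_eq0 negb_or => /andP[ht /prodf_neq0 zt].
  by split=> // j; apply: zt.
have [k [q hq]] : poly_quot d (fun t => lpoly s (fun j => (zl j).[t]) hl.[t]).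
  elim: s {f0} => [|[c [e1 e2]] s IH].
    apply: eq_poly_quot (poly_quot_horner d 0) => t _.
    by rewrite /lpoly big_nil horner0.
  have lin : poly_quot d (fun t => c * (hl.[t] ^ e1 * \prod_j (zl j).[t] ^ e2 j)).
    apply: (@poly_quotM _ (fun=> c)).
      by apply: eq_poly_quot (poly_quot_horner d c%:P) => t _; rewrite hornerC.
    apply: poly_quotM; first exact: poly_quot_exprz.
    have : forall j, poly_quot d (fun t => (zl j).[t] ^ e2 j).
      move=> j; rewrite /d (bigD1 j) //= mulrCA; exact: poly_quot_exprz.
    elim: (index_enum _) => [|j r IHr] hj.
      by apply: eq_poly_quot (poly_quot_horner d 1) => t _; rewrite big_nil hornerC.
    by apply: eq_poly_quot (poly_quotM (hj j) (IHr hj)) => t _; rewrite big_cons.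
  by apply: eq_poly_quot (poly_quotD lin IH) => t _; rewrite /lpoly big_cons.
pose bad := generic_poly zl hl.
have bad0 : bad != 0.
  have : bad.[1] != 0.
    apply/generic_polyP; have e1 j : (zl j).[1] = w j by rewrite zlE mulr1 addrCA subrr addr0.
    have e2 : hl.[1] = h1 by rewrite hlE mulr1 addrCA subrr addr0.
    by split=> [j|||a b]; rewrite ?e1 ?e2 //; apply: ww.
  by apply: contraNneq => ->; rewrite horner0.
(* The line passes through the generic point at t = 1, so [bad] is a nonzero polynomial, and q
   vanishes wherever [bad] does not. The given point is t = 0. *)
have q0 : q = 0.
  have : q * bad = 0.
    apply: poly_vanish => t; rewrite hornerM; case: (eqVneq bad.[t] 0) => [->|bt].
      by rewrite mulr0.
    have dt : d.[t] != 0.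
      by move: bt; rewrite /bad /generic_poly -/d 2!hornerM !mulf_eq0 !negb_or => /andP[/andP[]].
    by rewrite -hq // f0 ?mul0r //; apply/generic_polyP.
  by move/eqP; rewrite mulf_eq0 (negPf bad0) orbF => /eqP.
have d0 : d.[0] != 0.
  rewrite hornerM horner_prod mulf_eq0 negb_or hlE mulr0 addr0 h0.
  by apply/prodf_neq0 => j _; rewrite zlE mulr0 addr0.
have := hq 0 d0; rewrite q0 horner0 => /eqP; rewrite mulf_eq0 expf_eq0 (negPf d0) andbF orbF.
move/eqP=> <-; rewrite hlE mulr0 addr0; apply: eq_bigr => t _; congr (_ * (_ * _)).
by apply: eq_bigr => j _; rewrite zlE mulr0 addr0.
Qed.

Lemma generic_torus (z : 'I_n -> C) h : generic z h -> torus z h.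
Proof. by case. Qed.

Lemma reg_on_density (d f g : ('I_n -> C) -> C -> C) :
    laurent d -> (forall z h, generic z h -> d z h != 0) -> reg_on d f -> reg_on d g ->
    (forall z h, generic z h -> f z h = g z h) ->
  forall z h, torus z h -> d z h != 0 -> f z h = g z h.
Proof.
move=> ld d0 [f' [k [lf hf]]] [g' [l [lg hg]]] fg z h zh dz.
have lau : laurent (fun z h => f' z h * d z h ^+ l - g' z h * d z h ^+ k).
  by apply: laurentD; last apply: laurentN; apply: laurentM => //; apply: laurentX.
have van z' h' : generic z' h' -> f' z' h' * d z' h' ^+ l - g' z' h' * d z' h' ^+ k = 0.
  move=> gz; have tz := generic_torus gz; have dz' := d0 _ _ gz.
  have := fg _ _ gz; rewrite hf ?hg // => /eqP.
  by rewrite eqr_div ?expf_neq0 // => /eqP ->; rewrite subrr.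
have /eqP := laurent_density lau van zh; rewrite subr_eq0 => /eqP e; rewrite hf ?hg //; apply/eqP.
by rewrite eqr_div ?expf_neq0 //; apply/eqP.
Qed.
End Density.

(** * Denominators attached to inversions *)

Section Denominators.
Variables (C : numClosedFieldType) (n N : nat).
Implicit Types (I : word n N) (z : 'I_n -> C).

Definition inv_denom I z (h : C) : C :=
  \prod_(pq : 'I_n * 'I_n | (pq.2 < pq.1)%N && (I pq.1 < I pq.2)%N) (1 - h * z pq.2 / z pq.1).

Lemma laurent_inv_denom I : laurent (inv_denom I).
Proof. by apply: laurent_prod => pq _; apply: laurent_factor. Qed.

Lemma laurent_Dfun : laurent (@Dfun C n).
Proof. by do 2 apply: laurent_prod => ? _; apply: laurent_factor. Qed.

Lemma Dfun_pairs z h :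
  Dfun z h = \prod_(pq : 'I_n * 'I_n | (pq.2 < pq.1)%N) (1 - h * z pq.2 / z pq.1).
Proof. by rewrite /Dfun pair_big_dep. Qed.

Lemma reg_on_Dfun I f : reg_on (inv_denom I) f -> reg_on (@Dfun C n) f.
Proof.
apply: (@reg_on_dvd _ _ _ (fun z h => \prod_(pq : 'I_n * 'I_n |
  (pq.2 < pq.1)%N && ~~ (I pq.1 < I pq.2)%N) (1 - h * z pq.2 / z pq.1))).
  by apply: laurent_prod => pq _; apply: laurent_factor.
by move=> z h _; rewrite Dfun_pairs (bigID (fun pq : 'I_n * 'I_n => (I pq.1 < I pq.2)%N)).
Qed.

Lemma reg_on_Dfun_factor (p q : 'I_n) : (q < p)%N ->
  reg_on (@Dfun C n) (fun z h => (1 - h * z q / z p)^-1).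
Proof.
move=> qp; have := reg_onV (fun z (h : C) => 1 - h * z q / z p).
apply: (@reg_on_dvd _ _ _ (fun z h => \prod_(pq : 'I_n * 'I_n |
  (pq.2 < pq.1)%N && (pq != (p, q))) (1 - h * z pq.2 / z pq.1))).
  by apply: laurent_prod => pq _; apply: laurent_factor.
by move=> z h _; rewrite Dfun_pairs (bigD1 (p, q)).
Qed.

Lemma generic_Dfun z h : generic z h -> Dfun z h != 0.
Proof.
move=> [z0 h0 h1 zz]; rewrite Dfun_pairs; apply/prodf_neq0 => -[p q] /= qp.
rewrite subr_eq0 eq_sym -(inj_eq (mulIf (z0 p))) divfK // mul1r eq_sym.
by have /andP[] := zz q p (negbT (ltn_eqF qp)).
Qed.

Lemma generic_inU z h : generic z h -> inU z h.
Proof. by move=> gz; have [z0 h0] := generic_torus gz; split=> //; apply: generic_Dfun. Qed.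

Section Step.
Variable i : nat.
Hypothesis hi : (i.+1 < n)%N.
Local Notation a := (ord_lo hi).
Local Notation b := (ord_hi hi).

Lemma generic_swapz z h : generic z h -> generic (swapz i z) h.
Proof.
move=> [z0 h0 h1 zz]; split=> // [j|p q pq]; first exact: z0.
by apply: zz; rewrite (inj_eq (tau_inj hi)).
Qed.

(** [tau] maps the inversions of s_i(I) onto those of I other than (b, a). The additional factor is
    the denominator of R(z_i/z_(i+1), h). *)
Lemma inv_denom_swap I z h : (I b < I a)%N ->
  inv_denom I z h = inv_denom (swapw i I) (swapz i z) h * (1 - h * z a / z b).
Proof.
move=> Iba; rewrite /inv_denom (bigD1 (b, a)) /=; last by rewrite ltnSn.
rewrite mulrC; congr (_ * _).
have s2_inj : injective (fun pq : 'I_n * 'I_n => (tau i pq.1, tau i pq.2)).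
  by move=> [p q] [p' q'] [/(tau_inj hi) -> /(tau_inj hi) ->].
rewrite [RHS](reindex_inj s2_inj) /=.
apply: eq_big => [[p q]|[p q] _] /=; last by rewrite /swapz !tauK.
rewrite !swapwE !tauK //.
have [e|n1] := eqVneq (q, p) (a, b).
  by case: e => -> ->; rewrite eqxx andbF tau_lo tau_hi ltnNge leqnSn.
have [e|n2] := eqVneq (q, p) (b, a).
  by case: e => -> ->; rewrite [(I a < _)%N]ltnNge (ltnW Iba) !andbF.
rewrite (tau_ltn n1 n2); case: eqVneq => [[e1 e2]|_]; last by rewrite andbT.
by rewrite e1 e2 eqxx in n1.
Qed.

Lemma stilde_ext (f g : ('I_n -> C) -> C -> word n N -> C) z h :
  (forall u, f (swapz i z) h u = g (swapz i z) h u) -> stilde i f z h =1 stilde i g z h.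
Proof. by move=> e u; rewrite !(stildeE hi) !e. Qed.

Lemma reg_on_stilde d (f : ('I_n -> C) -> C -> word n N -> C) : laurent d ->
    (forall u, reg_on d (fun z h => f (swapz i z) h u)) ->
    reg_on d (fun z h => (1 - h * z a / z b)^-1) ->
  forall u, reg_on d (fun z h => stilde i f z h u).
Proof.
move=> ld rf rV u.
have rx : reg_on d (fun z _ => z a / z b) by apply: reg_on_laurent; apply: laurent_ratio.
have r1x : reg_on d (fun z _ => 1 - z a / z b).
  apply: reg_on_laurent; apply: laurentD; first exact: laurent_cst.
  by apply: laurentN; apply: laurent_ratio.
have rh : reg_on d (fun _ h => h) by apply: reg_on_laurent; apply: laurent_h.
have r1h : reg_on d (fun _ h => 1 - h).
  apply: reg_on_laurent; apply: laurentD; first exact: laurent_cst.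
  by apply: laurentN; apply: laurent_h.
case e1: (u a == u b).
  by apply: eq_reg_on (rf u) => z h _ _; rewrite (stildeE hi) e1.
case e2: (u a < u b)%N.
  have t1 := reg_onM (reg_onM (reg_onM rh r1x) rV) (rf (swapw i u)).
  have t2 := reg_onM (reg_onM (reg_onM r1h rx) rV) (rf u).
  by apply: eq_reg_on (reg_onD ld t1 t2) => z h _ _; rewrite (stildeE hi) e1 e2 !mulrA.
have t1 := reg_onM (reg_onM r1x rV) (rf (swapw i u)).
have t2 := reg_onM (reg_onM r1h rV) (rf u).
by apply: eq_reg_on (reg_onD ld t1 t2) => z h _ _; rewrite (stildeE hi) e1 e2 !mulrA.
Qed.

End Step.
End Denominators.

(** * Construction of the vectors and transfer from generic points *)

Section Construction.
Variables (C : numClosedFieldType) (n m : nat) (lam : 'I_m.+1 -> nat).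
Hypothesis hlam : (\sum_(k < m.+1) lam k)%N = n.
Local Notation hN := (isT : (0 < m.+1)%N).
Local Notation wordN := (word n m.+1).
Implicit Types (I J u : wordN) (z : 'I_n -> C).

Definition descent I (i : 'I_n) : bool := (i.+1 < n)%N && (wat I i.+1 < wat I i)%N.

(** Whichever descent is picked, the result is the same: [xi_generic] identifies it with the
    explicit formula, so paths need not be compared. *)
Fixpoint xi_rec (d : nat) I : ('I_n -> C) -> C -> wordN -> C :=
  if d is d'.+1 then
    if [pick i | descent I i] is Some i then stilde i (xi_rec d' (swapw i I))
    else fun _ _ => vb I
  else fun _ _ => vb I.

(* Undoing a descent creates an ascent, so [n * n] steps always suffice. *)
Definition xi I := xi_rec (n * n) I.

Lemma ascents_le I : (ascents I <= n * n)%N.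
Proof.
rewrite /ascents -[X in (X * X)%N](card_ord n) -card_prod -sum1_card.
by apply: leq_sum => pq _; case: (_ && _).
Qed.

Lemma descentP I i : descent I i ->
  exists hi : (i.+1 < n)%N, (I (ord_hi hi) < I (ord_lo hi))%N.
Proof.
by case/andP => hi lt; exists hi; rewrite -!wat_ord.
Qed.

Lemma no_descent_Imin I : inIlam lam I -> (forall i, descent I i = false) -> I = Imin lam hN.
Proof.
move=> hI nd; apply: sorted_word_Imin => // i hi; rewrite leqNgt; apply/negP => lt.
by have /negP[] := negbT (nd (ord_lo hi)); rewrite /descent hi -!wat_ord in lt *.
Qed.

(** P takes the vector as well as the word, so that the step is free of the recursion depth. *)
Lemma xi_ind (P : wordN -> (('I_n -> C) -> C -> wordN -> C) -> Prop) :
    P (Imin lam hN) (fun _ _ => vb (Imin lam hN)) ->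
    (forall I i (hi : (i.+1 < n)%N) f, inIlam lam I -> (I (ord_hi hi) < I (ord_lo hi))%N ->
       P (swapw i I) f -> P I (stilde i f)) ->
  forall I, inIlam lam I -> P I (xi I).
Proof.
move=> P0 PS I hI.
suff gen d : (n * n - ascents I <= d)%N -> P I (xi_rec d I).
  exact: gen (leq_subr _ _).
elim: d I hI => [|d IH] I hI dI /=.
  (* At depth 0 the word has at least n * n ascents, so undoing a descent would exceed the bound of
     [ascents_le]. *)
  case: (pickP (descent I)) => [i /descentP[hi lt]|nd]; last by rewrite (no_descent_Imin hI nd).
  have := ascents_le (swapw i I); rewrite (ascents_swap lt).
  by move: dI; lia.
case: pickP => [i /descentP[hi lt]|nd]; last by rewrite (no_descent_Imin hI nd).
apply: (PS I i hi) => //; apply: IH; first by rewrite inIlam_swapw.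
by rewrite (ascents_swap lt); lia.
Qed.

Lemma xi_Imin : xi (Imin lam hN) = fun _ _ => vb (Imin lam hN).
Proof.
rewrite /xi; case: (n * n)%N => //= d; case: pickP => // i /descentP[hi].
by rewrite ltnNge Imin_mono // leqnSn.
Qed.

Lemma Xcoef_Imin z h u : generic z h -> Xcoef lam (Imin lam hN) z h u = vb (Imin lam hN) u.
Proof.
move=> gz; have hm : inIlam lam (Imin lam hN : wordN) by apply: Imin_inIlam.
rewrite /vb; have [->|nu] := eqVneq u (Imin lam hN).
  rewrite /Xcoef hm Xformula_diag // /Xdiag big1 // => p _; rewrite big_pred0 // => q.
  apply/andP => -[lt qp]; have := Imin_mono hN hlam (ltnW qp).
  by rewrite leqNgt lt.
rewrite /Xcoef; case: ifP => // hu; apply/eqP; apply: contraT => nz; case/eqP: nu.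
apply: dominating_Imin => // k; rewrite ltnS => km.
exact: (Xformula_dominating hm hu gz nz).
Qed.

Lemma xi_generic I z h u : inIlam lam I -> generic z h -> xi I z h u = Xcoef lam I z h u.
Proof.
move=> hI; move: I hI z h u; apply: (xi_ind (P := fun I f => forall z h u,
  generic z h -> f z h u = Xcoef lam I z h u)) => [z h u gz|I i hi f hI lt IH z h u gz].
  by rewrite Xcoef_Imin.
have hsI : inIlam lam (swapw i I) by rewrite inIlam_swapw.
rewrite -[in RHS](swapwK I hi) (Xcoef_swap hi) //.
by apply: (stilde_ext hi) => v; apply: IH; apply: generic_swapz.
Qed.

Lemma xi_reg_inv I u : inIlam lam I -> reg_on (inv_denom I) (fun z h => xi I z h u).
Proof.
move=> hI; move: I hI u; apply: (xi_ind (P := fun I f => forall u,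
  reg_on (inv_denom I) (fun z h => f z h u))) => [u|I i hi f hI lt IH].
  by apply: reg_on_laurent; apply: laurent_cst.
apply: (@reg_on_stilde _ _ _ _ hi); first exact: laurent_inv_denom.
  move=> u; have := reg_on_swapz hi (IH u).
  apply: (@reg_on_dvd _ _ _ (fun z h => 1 - h * z (ord_lo hi) / z (ord_hi hi))).
    exact: laurent_factor.
  by move=> z h _; apply: inv_denom_swap.
have := reg_onV (fun z (h : C) => 1 - h * z (ord_lo hi) / z (ord_hi hi)).
apply: (@reg_on_dvd _ _ _ (fun z h => inv_denom (swapw i I) (swapz i z) h)).
  by apply: laurent_swapz => //; apply: laurent_inv_denom.
by move=> z h _; rewrite mulrC; apply: inv_denom_swap.
Qed.

Lemma xi_reg I u : inIlam lam I -> reg_on (@Dfun C n) (fun z h => xi I z h u).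
Proof. by move=> hI; apply: reg_on_Dfun (xi_reg_inv u hI). Qed.

Lemma xi_density (f : ('I_n -> C) -> C -> C) I u : inIlam lam I -> reg_on (@Dfun C n) f ->
    (forall z h, generic z h -> xi I z h u = f z h) ->
  forall z h, inU z h -> xi I z h u = f z h.
Proof.
move=> hI rf e z h /inUP[zh dz].
exact: (reg_on_density (laurent_Dfun C n) (@generic_Dfun C n) (xi_reg u hI) rf e zh dz).
Qed.

Lemma xi_swap I i z h u : inIlam lam I -> (i.+1 < n)%N -> inU z h -> inU (swapz i z) h ->
  xi (swapw i I) z h u = stilde i (xi I) z h u.
Proof.
move=> hI hi /inUP[zh dz] /inUP[_ dsz].
have hsI : inIlam lam (swapw i I) by rewrite inIlam_swapw.
(* The left side and R have poles along D(z) = 0, while K_i moves those of xi_I to D(s_i z) = 0; the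
   two sides are compared over the product. *)
pose d z (h : C) := Dfun z h * Dfun (swapz i z) h.
have lDs : laurent (fun z (h : C) => Dfun (swapz i z) h).
  by apply: laurent_swapz => //; apply: laurent_Dfun.
have ld : laurent d by apply: laurentM => //; apply: laurent_Dfun.
have widen f : reg_on (@Dfun C n) f -> reg_on d f.
  by apply: reg_on_dvd lDs _ => *.
apply: (@reg_on_density _ _ d (fun z h => xi (swapw i I) z h u)
  (fun z h => stilde i (xi I) z h u)) => //.
- by move=> z' h' gz; rewrite mulf_neq0 ?generic_Dfun //; apply: generic_swapz.
- exact/widen/xi_reg.
- apply: (@reg_on_stilde _ _ _ _ hi) => // [v|]; last first.
    by apply: widen; apply: reg_on_Dfun_factor; rewrite /= ltnSn.
  have := reg_on_swapz hi (xi_reg v hI).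
  apply: (@reg_on_dvd _ _ _ (@Dfun C n)); first exact: laurent_Dfun.
  by move=> z' h' _; rewrite /d mulrC.
- move=> z' h' gz; rewrite xi_generic // (Xcoef_swap hi) //.
  apply: (stilde_ext hi) => v; rewrite xi_generic //; exact: generic_swapz.
by rewrite mulf_neq0.
Qed.

Lemma reg_on_Xdiag I : reg_on (@Dfun C n) (Xdiag I).
Proof.
apply: reg_on_prod => p _; apply: reg_on_prod => q /andP[_ qp].
apply: reg_onM; last exact: reg_on_Dfun_factor.
apply: reg_on_laurent; apply: laurentD; first exact: laurent_cst.
by apply: laurentN; apply: laurent_ratio.
Qed.

End Construction.

Theorem theorem8p2 (C : numClosedFieldType) (n N : nat) (lam : 'I_N -> nat)
    (hN : (0 < N)%N) (hlam : (\sum_(k < N) lam k)%N = n) :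
  let Xi_ok (xi : word n N -> ('I_n -> C) -> C -> word n N -> C) : Prop :=
    [/\ (* xi_I in (C^N)^{(x)n} (x) C[z^{+-1},h^{+-1},D^{-1}] *)
        forall I, inIlam lam I -> forall u, regular (fun z h => xi I z h u),
        (* xi_{I^min} = v_{I^min} *)
        forall z h, inU z h -> forall u, xi (Imin lam hN) z h u = vb (Imin lam hN) u
      & (* xi_{s_i(I)} = tilde s_i xi_I, i = 1..n-1 *)
        forall I, inIlam lam I -> forall i : nat, (i.+1 < n)%N ->
          forall z h, inU z h -> inU (swapz i z) h ->
          forall u, xi (swapw i I) z h u = stilde i (xi I) z h u] in
  exists xi, Xi_ok xi
    /\ (forall xi', Xi_ok xi' ->
          forall I, inIlam lam I -> forall z h, inU z h ->
          forall u, xi' I z h u = xi I z h u)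
    /\ [/\ (* xi_I = sum_{J <=_id I} X_{I,J} v_J *)
           forall I, inIlam lam I -> forall z h, inU z h ->
             forall J, ~~ (inIlam lam J && le_id J I) -> xi I z h J = 0,
           (* X_{I,I} *)
           forall I, inIlam lam I -> forall z h, inU z h ->
             xi I z h I = Xdiag I z h
         & (* X_{I,J} for all I, J *)
           forall I J, inIlam lam I -> inIlam lam J -> forall z h, generic z h ->
             xi I z h J = Xformula lam I J z h].
Proof.
case: N lam hN hlam => // m lam hN hlam Xi_ok; rewrite (bool_irrelevance hN isT) in Xi_ok *.
exists (@xi C n m); split; last split; last split.
- split=> [I hI u|z h zU u|I hI i hi z h zU szU u].
  + by apply/regularP; exact: (xi_reg C hlam u hI).
  + by rewrite (xi_Imin C hlam).
  + exact: (xi_swap hlam).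
- move=> xi' [reg' min' swap'] I hI z h zU u; symmetry; move: z h zU.
  apply: (xi_density hlam hI); first by apply/regularP; apply: reg'.
  (* Generic points are stable under [swapz], so both families obey the recursion at every step of
     the path. The predicate ignores the vector of the induction; [xi] is unfolded through [xi_swap]
     instead. *)
  move: I hI u; apply: (xi_ind (C := C) hlam (P := fun I _ => forall u z h,
    generic z h -> xi I z h u = xi' I z h u)) => [u z h gz|I i hi f hI lt IH u z h gz].
    by rewrite min' ?(xi_Imin C hlam) //; apply: generic_inU.
  have hsI : inIlam lam (swapw i I) by rewrite inIlam_swapw.
  have sgz := generic_swapz hi gz.
  rewrite -(swapwK I hi) swap' ?(xi_swap hlam) //; try exact: generic_inU.
  by apply: (stilde_ext hi) => v; apply: IH.
- move=> I hI z h zU J nJ; move: z h zU.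
  apply: (xi_density hlam hI); first by apply: reg_on_laurent; apply: laurent_cst.
  move=> z h gz; rewrite (xi_generic hlam) // /Xcoef; case: ifP => // hJ.
  by apply: Xformula_le_id => //; rewrite hJ in nJ.
- move=> I hI; apply: (xi_density hlam hI); first exact: reg_on_Xdiag.
  by move=> z h gz; rewrite (xi_generic hlam) // /Xcoef hI Xformula_diag.
- by move=> I J hI hJ z h gz; rewrite (xi_generic hlam) // /Xcoef hJ.
Qed.
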